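(* Let $L=(l_1,\dots,l_n)$ be a generic polygonal linkage, and let $(P,\xi)\in\widetilde M_3(L)$ be a generic planar cyclic critical point of the function $S$, i.e. $P$ is a planar cyclic polygon with side lengths $l_1,\dots,l_n$ and $\xi$ is a unit vector orthogonal to the affine hull of $P$ (generic meaning that $P$ is non-central and $(P,\xi)$ is a non-degenerate critical point of $S$). Then the Morse index of $S:\widetilde M_3(L)\to\mathbb{R}$ at $(P,\xi)$ is $$\mu(P,\xi)=2e(P)-2\omega_P-2 .$$
   Context: A polygonal $n$-linkage is a sequence of positive numbers $L=(l_1,\dots,l_n)$. A polygon with side lengths $L$ is a sequence of points $P=(p_1,\dots,p_n)$ in $\mathbb{R}^3$ with $|p_ip_{i+1}|=l_i$ (indices modulo $n$). The decorated moduli space $\widetilde M_3(L)$ is the set of pairs $(P,\xi)$, where $P$ is a polygon in $\mathbb{R}^3$ with side lengths $L$ and $\xi\in S^2$ is a unit vector, modulo the diagonal action of orientation-preserving isometries of $\mathbb{R}^3$ (acting on $\xi$ by their linear parts). $L$ is assumed generic; in particular no polygon with side lengths $L$ lies on a line, so that $\widetilde M_3(L)$ is a smooth closed manifold of dimension $2n-4$. The vector area function is $S(P,\xi)=\tfrac12\langle p_1\times p_2+p_2\times p_3+\dots+p_n\times p_1,\ \xi\rangle$. A planar polygon is cyclic if all its vertices lie on a circle; let $O$ be the centre of this circle. $P$ is central if one of its edges contains $O$. For a planar cyclic non-central $P$ and $\xi$ orthogonal to the plane of $P$, orient the plane by the coorientation $\xi$ (so that a counterclockwise polygon has positive $S$).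 Put $\varepsilon_i=1$ if $O$ lies to the left of the oriented edge $p_ip_{i+1}$ and $\varepsilon_i=-1$ if it lies to the right. Then $e(P)$ is the number of indices $i$ with $\varepsilon_i=1$, and $\omega_P$ is the winding number of $P$ around $O$ with respect to this orientation. The Morse index is the number of negative eigenvalues of the Hessian. *)

(* Defs.v *)
From HB Require Import structures.
From mathcomp Require Import all_boot all_order all_algebra.
From mathcomp Require Import all_classical all_reals all_analysis.

Set Implicit Arguments.
Unset Strict Implicit.
Unset Printing Implicit Defensive.
Import Order.TTheory GRing.Theory Num.Theory numFieldNormedType.Exports.
Local Open Scope classical_set_scope.
Local Open Scope ring_scope.

(* The library norm on row vectors is the sup norm, so the Euclidean structure
   of R^3 is introduced here. *)
Definition dot (R : realType) (u v : 'rV[R]_3) : R :=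
  \sum_(k < 3) u 0 k * v 0 k.

Definition enorm (R : realType) (u : 'rV[R]_3) : R := Num.sqrt (dot u u).

(* Indices are taken modulo 3 by [ordS]. *)
Definition cross (R : realType) (u v : 'rV[R]_3) : 'rV[R]_3 :=
  \row_(k < 3) (u 0 (ordS k) * v 0 (ordS (ordS k))
                - u 0 (ordS (ordS k)) * v 0 (ordS k)).

(* A polygon is the matrix whose i-th row is its i-th vertex; vertices are
   numbered from 0, and [ordS i] is i + 1 modulo n. *)
Definition polygon_with_sides (R : realType) (n : nat)
    (L : 'I_n -> R) (P : 'M[R]_(n, 3)) : Prop :=
  forall i, enorm (row (ordS i) P - row i P) = L i.

Definition collinear_polygon (R : realType) (n : nat) (P : 'M[R]_(n, 3)) :
    Prop :=
  exists a v : 'rV[R]_3, forall i, exists t : R, row i P = a + t *: v.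

Definition linkage (R : realType) (n : nat) (L : 'I_n -> R) : Prop :=
  forall i, 0 < L i.

Definition generic_linkage (R : realType) (n : nat) (L : 'I_n -> R) : Prop :=
  forall P : 'M[R]_(n, 3), polygon_with_sides L P -> ~ collinear_polygon P.

Notation config R n := ('M[R]_(n, 3) * 'rV[R]_3)%type.

Definition decorated (R : realType) (n : nat) (L : 'I_n -> R) :
    set (config R n) :=
  [set x | polygon_with_sides L x.1 /\ enorm x.2 = 1].

(* Orientation-preserving isometries are p |-> p A + b with A in SO(3); they
   act on the decoration by the linear part A. *)
Definition isometric (R : realType) (n : nat) (x y : config R n) : Prop :=
  exists (A : 'M[R]_3) (b : 'rV[R]_3),
    [/\ A *m A^T = 1%:M, \det A = 1,
        forall i, row i y.1 = row i x.1 *m A + b & y.2 = x.2 *m A].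

Definition iso_class (R : realType) (n : nat) (x : config R n) :
    set (config R n) :=
  [set y | isometric x y].

(* Points of the moduli space are whole isometry classes. *)
Definition decorated_moduli (R : realType) (n : nat) (L : 'I_n -> R) :
    set (set (config R n)) :=
  [set iso_class x | x in decorated L].

Definition vector_area (R : realType) (n : nat) (x : config R n) : R :=
  2^-1 * dot (\sum_(i < n) cross (row i x.1) (row (ordS i) x.1)) x.2.

(* The value on a class is read off a chosen representative; [vector_area] is
   constant on the classes of the moduli space. *)
Definition moduli_area (R : realType) (n : nat) (X : set (config R n)) : R :=
  vector_area (get X).

Fixpoint Ck_on (R : realType) (V W : normedModType R) (k : nat)
    (U : set V) (f : V -> W) : Prop :=
  match k with
  | 0%N => forall x, U x -> {for x, continuous f}
  | j.+1 => (forall x, U x -> differentiable f x) /\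
            forall v, Ck_on j U (fun x => 'D_v f x)
  end.

Definition smooth_on (R : realType) (V W : normedModType R)
    (U : set V) (f : V -> W) : Prop :=
  forall k, Ck_on k U f.

Definition moduli_dim (n : nat) : nat := (2 * n - 4)%N.

(* Local parametrisations, centred at X, of the quotient manifold
   [decorated_moduli L].  A smooth map into a quotient by a free action lifts
   locally to a smooth map upstairs, so a parametrisation is presented by such
   a lift [phi]; its inverse chart is presented by a map [c] on the total space
   which is constant on classes.  The last three clauses say that
   [iso_class \o phi] and the map induced by [c] are mutually inverse between
   [U] and the (open) image of [W] in the moduli space. *)
Definition local_param (R : realType) (n : nat) (L : 'I_n -> R)
    (X : set (config R n)) (phi : 'rV[R]_(moduli_dim n) -> config R n) : Prop :=
  exists (c : config R n -> 'rV[R]_(moduli_dim n))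
         (U : set 'rV[R]_(moduli_dim n)) (W : set (config R n)),
    [/\ decorated_moduli L X, open U, U 0, iso_class (phi 0) = X
      & smooth_on U phi] /\
    [/\ open W, smooth_on W c,
        (forall u, U u -> [/\ decorated L (phi u), W (phi u) & c (phi u) = u]),
        (forall y z, decorated L y -> decorated L z -> W y -> W z ->
           isometric y z -> c y = c z)
      & (forall y, decorated L y -> W y ->
           U (c y) /\ isometric (phi (c y)) y)].

Definition hessian (R : realType) (d : nat) (g : 'rV[R]_d -> R) (x : 'rV[R]_d) :
    'M[R]_d :=
  \matrix_(i, j) 'D_(delta_mx 0 i) (fun y => 'D_(delta_mx 0 j) g y) x.

(* Eigenvalues are counted with multiplicity, as roots of the (split)
   characteristic polynomial. *)
Definition num_neg_eigenvalues (R : realType) (d : nat) (H : 'M[R]_d) (m : nat) :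
    Prop :=
  exists2 s : seq R, char_poly H = \prod_(a <- s) ('X - a%:P) &
    count (fun a => a < 0) s = m.

Definition nondegenerate_critical_point (R : realType) (n : nat)
    (L : 'I_n -> R) (f : set (config R n) -> R) (X : set (config R n)) : Prop :=
  exists2 phi, local_param L X phi &
    let g := fun u => f (iso_class (phi u)) in
    (forall v, 'D_v g 0 = 0) /\ hessian g 0 \in unitmx.

Definition has_morse_index (R : realType) (n : nat) (L : 'I_n -> R)
    (f : set (config R n) -> R) (X : set (config R n)) (m : nat) : Prop :=
  (exists phi, local_param L X phi) /\
  forall phi, local_param L X phi ->
    num_neg_eigenvalues (hessian (fun u => f (iso_class (phi u))) 0) m.

Definition orthogonal_to_polygon (R : realType) (n : nat)
    (P : 'M[R]_(n, 3)) (xi : 'rV[R]_3) : Prop :=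
  forall i j, dot (row i P - row j P) xi = 0.

(* The circle lies in the plane of the polygon, which is the plane orthogonal
   to xi through its vertices. *)
Definition inscribed_with_centre (R : realType) (n : nat)
    (P : 'M[R]_(n, 3)) (xi O : 'rV[R]_3) : Prop :=
  (forall i, dot (row i P - O) xi = 0) /\
  exists2 r : R, 0 < r & forall i, enorm (row i P - O) = r.

Definition central (R : realType) (n : nat)
    (P : 'M[R]_(n, 3)) (O : 'rV[R]_3) : Prop :=
  exists (i : 'I_n) (t : R),
    0 <= t <= 1 /\ O = row i P + t *: (row (ordS i) P - row i P).

(* In an oriented plane with positive unit normal xi, <u x v, xi> is the
   determinant of (u, v); O is to the left of pq iff det (q - p, O - p) > 0. *)
Definition left_of_edge (R : realType) (n : nat) (P : 'M[R]_(n, 3))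
    (xi O : 'rV[R]_3) (i : 'I_n) : bool :=
  0 < dot (cross (row (ordS i) P - row i P) (O - row i P)) xi.

Definition num_left_edges (R : realType) (n : nat) (P : 'M[R]_(n, 3))
    (xi O : 'rV[R]_3) : nat :=
  #|[pred i : 'I_n | left_of_edge P xi O i]|.

(* Signed angle in ]-pi, pi[ from u to v, for u and v not opposite. *)
Definition signed_angle (R : realType) (xi u v : 'rV[R]_3) : R :=
  Num.sg (dot (cross u v) xi) * acos (dot u v / (enorm u * enorm v)).

(* Total variation of the argument around O, in turns, for O on no edge; each
   edge p_i p_(i+1) then sweeps the signed angle in ]-pi, pi[. *)
Definition winding_number (R : realType) (n : nat) (P : 'M[R]_(n, 3))
    (xi O : 'rV[R]_3) : R :=
  (\sum_(i < n) signed_angle xi (row i P - O) (row (ordS i) P - O)) / (2 * pi).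

(* Main.v *)
Require Import Defs.
From HB Require Import structures.
From mathcomp Require Import all_boot all_order all_algebra.
From mathcomp Require Import all_classical all_reals all_analysis.
From mathcomp Require Import complex ring lra zify.

Set Implicit Arguments.
Unset Strict Implicit.
Unset Printing Implicit Defensive.
Import Order.TTheory GRing.Theory Num.Theory numFieldNormedType.Exports.
Local Open Scope classical_set_scope.
Local Open Scope ring_scope.

(* Put the centre of the circle at 0, xi upwards, and pick a point c of the
   circle which is not a vertex; let t_i be the stereographic coordinate of p_i
   seen from c, so that t_i = oo is c itself.  Let l_i = cot(a_i) / 2, where
   2 a_i is the angle under which the edge i is seen from 0.  These are Lagrange
   multipliers: S - sum_i l_i |p_(i+1) - p_i|^2 / 2 (with a further term for
   |xi| = 1) is critical, so in any chart the Hessian of S is a quadratic form Q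
   in the first derivative of the chart.

   Rotating the normal back to xi, a tangent vector consists of horizontal
   displacements w and vertical displacements z.  The planar part of Q extends
   to arbitrary horizontal displacements as
   Q(w) = sum_i (w_i x w_(i+1) - l_i |w_(i+1) - w_i|^2), and the displacements
   which do not change the edge lengths are Q-orthogonal to those along the
   circle; on the latter, Q is the vertical part of the Hessian.  So both parts
   together are Q(W), with W_i = w_i + (z_i / r) J p_i and J the quarter turn.
   Writing W_i as the complex multiple U_i / (1 + i t_i) gives
   Q(W) = - 1/2 sum_i |U_(i+1) - U_i|^2 / (t_i - t_(i+1)).

   If N is the number of i with t_(i+1) < t_i, this form has index at most
   2 (N - 1) and coindex at most 2 (n - N - 1), because the differences
   U_(i+1) - U_i and t_i - t_(i+1) sum up to 0.  The two bounds add up to the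
   dimension 2 n - 4, so a nondegenerate Hessian has index 2 N - 2.  Finally
   omega = e - N, comparing the angles of the edges seen from 0 and from c. *)

(** * Index of a quadratic form *)

(** The [f i] with [P i] form a matrix with fewer columns than rows, so its left kernel is
    nonzero. *)
Lemma common_kernel (F : fieldType) (d : nat) (I : finType) (P : pred I)
    (f : I -> 'cV[F]_d) :
  (#|P| < d)%N ->
  exists2 w : 'rV[F]_d, w != 0 & forall i, P i -> w *m f i = 0.
Proof.
move=> ltPd; pose M := \matrix_(i < d, j < #|P|) f (enum_val j) i 0.
have kM0 : kermx M != 0.
  by rewrite kermx_eq0 /row_free; apply: contraTneq ltPd => <-;
     rewrite -leqNgt rank_leq_col.
exists (nz_row (kermx M)); first by rewrite nz_row_eq0.
move=> i Pi; have /sub_kermxP/matrixP wM := nz_row_sub (kermx M).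
apply/matrixP => a b; rewrite !ord1 mxE [RHS]mxE.
have Pi' : i \in P by [].
have wM0 := wM 0 (enum_rank_in Pi' i); rewrite !mxE in wM0; rewrite -[RHS]wM0.
by apply: eq_bigr => k _; rewrite [M _ _]mxE enum_rankK_in.
Qed.

Lemma char_poly_conj (F : comNzRingType) (d : nat) (U V A : 'M[F]_d) :
  V *m U = 1%:M -> char_poly (V *m A *m U) = char_poly A.
Proof.
move=> VU; rewrite /char_poly.
have -> : char_poly_mx (V *m A *m U) =
    map_mx polyC V *m char_poly_mx A *m map_mx polyC U.
  rewrite /char_poly_mx mulmxBr mulmxBl !map_mxM; congr (_ - _).
  by rewrite scalar_mxC -mulmxA -map_mxM VU map_mx1 mulmx1.
by rewrite !det_mulmx mulrAC -det_mulmx -map_mxM VU map_mx1 det1 mul1r.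
Qed.

Section Spectral.
Variables (R : realType) (d : nat).
Local Notation C := R[i].
Local Notation toC := (map_mx (real_complex R)).

Lemma real_diag (D : 'rV[C]_d) : D \is a mxOver Num.real ->
  exists E : 'rV[R]_d, D = toC E.
Proof.
move=> Dr; exists (map_mx (@complex.Re R) D).
apply/matrixP => i j; rewrite !mxE.
by rewrite RRe_real //; move/mxOverP: Dr; apply.
Qed.

(** Over [R[i]] the matrix is Hermitian, hence unitarily diagonalisable with real eigenvalues, and
    the factorisation of the characteristic polynomial descends to [R]. The change of basis [U]
    stays complex. *)
Lemma symmetric_spectral (H : 'M[R]_d) : H^T = H ->
  exists (U : 'M[C]_d) (D : 'rV[R]_d),
    [/\ map_mx Num.conj U^T *m U = 1%:M,
        toC H = map_mx Num.conj U^T *m diag_mx (toC D) *m U &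
        char_poly H = \prod_(i < d) ('X - (D 0 i)%:P)].
Proof.
move=> Hsym.
have Hs : toC H \is symmetricmx.
  apply/is_hermitianmxP; rewrite expr0 scale1r.
  by rewrite map_mx_id // map_trmx Hsym.
have Hr : toC H \is a mxOver Num.real.
  by apply/mxOverP => i j; rewrite mxE complex_real.
have Hh := realsym_hermsym Hs Hr.
have /real_diag[D ED] := hermitian_spectral_diag_real Hh.
have /orthomx_spectralP := hermitian_normalmx Hh.
move: (spectral_unitarymx (toC H)); rewrite {}ED.
move: (spectralmx (toC H)) => U Uu.
rewrite invmx_unitary // => E.
have VU : map_mx Num.conj U^T *m U = 1%:M.
  by rewrite -invmx_unitary // mulVmx // unitarymx_unit.
exists U, D; split => //.
apply: (map_poly_inj (real_complex R)).
rewrite map_char_poly E char_poly_conj // char_poly_trig ?diag_mx_is_trig //.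
rewrite rmorph_prod; apply: eq_bigr => i _.
by rewrite rmorphB /= map_polyX map_polyC !mxE eqxx mulr1n.
Qed.

End Spectral.

Section Index.
Variables (R : realType) (d : nat).
Local Notation C := R[i].
Local Notation toC := (map_mx (real_complex R)).

Lemma conj_complex_i : Num.conj ('i%C : C) = - 'i%C.
Proof. by apply/eqP; rewrite eq_complex /= oppr0 !eqxx. Qed.

(** As the diagonalising basis is complex, bounds known on real vectors must be carried over to
    complex ones; the mixed terms cancel because [H] is symmetric. *)
Lemma hermitian_form_rect (H : 'M[R]_d) (a b : 'rV[R]_d) : H^T = H ->
  let v := toC a + 'i%C *: toC b in
  (v *m toC H *m map_mx Num.conj v^T) 0 0 =
  real_complex R ((a *m H *m a^T) 0 0 + (b *m H *m b^T) 0 0).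
Proof.
move=> Hsym v.
have -> : map_mx Num.conj v^T = toC a^T - 'i%C *: toC b^T.
  apply/matrixP => i j; rewrite !mxE rmorphD rmorphM /=.
  by rewrite conj_complex_i mulNr !conj_Creal ?complex_real.
have sw : b *m H *m a^T = a *m H *m b^T.
  apply: trmx_inj; rewrite [in RHS](_ : a *m H *m b^T = (b *m H *m a^T)^T).
    by rewrite trmxK; apply/matrixP => i j; rewrite !ord1 mxE.
  by rewrite !trmx_mul !trmxK Hsym mulmxA.
rewrite /v !mulmxDl !mulmxBr -!scalemxAl -!scalemxAr -!map_mxM /= sw.
by rewrite scalerA -expr2 sqr_i scaleN1r opprK addrA subrK !mxE -rmorphD.
Qed.

(** Dimension count: with more negative eigenvalues than conditions, a nonzero combination of
    eigenvectors with negative eigenvalues satisfies every condition [ell i]. So do its real and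
    imaginary parts, whose values under the form are nonnegative but have a negative sum. *)
Lemma card_negative_spectrum (H : 'M[R]_d) (U : 'M[C]_d) (D : 'rV[R]_d)
    (I : finType) (P : pred I) (ell : I -> 'cV[R]_d) :
  H^T = H -> map_mx Num.conj U^T *m U = 1%:M ->
  toC H = map_mx Num.conj U^T *m diag_mx (toC D) *m U ->
  (forall v : 'rV[R]_d, (forall i, P i -> v *m ell i = 0) ->
     0 <= (v *m H *m v^T) 0 0) ->
  (#|[pred i | (D 0 i < 0)%R]| <= #|P|)%N.
Proof.
move=> Hsym VU HE Hpos; rewrite leqNgt; apply/negP => lt_card.
(* Conditions on the row [w] of eigencoordinates: [inl i] kills the coordinate of a nonnegative
   eigenvalue, [inr i] imposes [ell i] on [w *m U]. *)
pose f (k : 'I_d + I) : 'cV[C]_d :=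
  match k with inl i => delta_mx i 0 | inr i => U *m toC (ell i) end.
pose Q (k : 'I_d + I) := match k with inl i => 0 <= D 0 i | inr i => P i end.
have cQ : (#|Q| < d)%N.
  rewrite -sum1_card big_sumType /= !sum1_card.
  rewrite -[ltnRHS](card_ord d) -(cardC [pred i | D 0 i < 0]) addnC.
  rewrite (@eq_card _ [pred i | 0 <= D 0 i] [predC [pred i | D 0 i < 0]]).
    by rewrite ltn_add2r.
  by move=> i; rewrite !inE leNgt.
have [w w0 wf] := common_kernel f cQ.
have Dw i : 0 <= D 0 i -> w 0 i = 0.
  move=> Di; have /matrixP/(_ 0 0) := wf (inl i) Di.
  by rewrite -colE !mxE.
pose v := w *m U.
pose a := map_mx (@complex.Re R) v; pose b := map_mx (@complex.Im R) v.
have vE : v = toC a + 'i%C *: toC b.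
  by apply/matrixP => i j; rewrite !mxE; case: (\sum_k _) => x y /=; simpc.
have vell i : P i -> a *m ell i = 0 /\ b *m ell i = 0.
  move=> Pi; have := wf (inr i) Pi; rewrite /f mulmxA -/v vE mulmxDl -scalemxAl.
  rewrite -!map_mxM => /matrixP E; split; apply/matrixP => x y.
    by have := E x y; rewrite !mxE; simpc => -[].
  by have := E x y; rewrite !mxE; simpc => -[].
have := hermitian_form_rect a b Hsym; rewrite /= -vE HE.
have UV : U *m map_mx Num.conj U^T = 1%:M by apply: mulmx1C.
have -> : v *m (map_mx Num.conj U^T *m diag_mx (toC D) *m U) *m map_mx Num.conj v^T
    = w *m diag_mx (toC D) *m map_mx Num.conj w^T.
  rewrite /v trmx_mul map_mxM !mulmxA -(mulmxA w U) UV mulmx1.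
  by rewrite -(mulmxA _ U) UV mulmx1.
rewrite mxE (eq_bigr (fun i => real_complex R (D 0 i) * `|w 0 i| ^+ 2)); last first.
  move=> i _; rewrite mul_mx_diag !mxE mulrAC -normCK mulrC //.
move=> E.
have /eqP/matrixP w_ex : w != 0 by [].
have [i wi] : exists i, w 0 i != 0.
  case: (pickP (fun i => w 0 i != 0)) => [i wi|wn]; first by exists i.
  case: w_ex => x y; rewrite ord1 mxE; apply/eqP; move/negbT: (wn y).
  by rewrite negbK.
have Di : D 0 i < 0 by rewrite ltNge; apply: contra wi => /Dw ->.
have : (0 : C) < 0.
  apply: (@le_lt_trans _ _ (\sum_i real_complex R (D 0 i) * `|w 0 i| ^+ 2)).
    rewrite E ler0c addr_ge0 //; apply: Hpos => k Pk.
      by case: (vell k Pk).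
    by case: (vell k Pk).
  rewrite (bigD1 i) //= -[ltRHS]addr0 ltr_leD //.
    by rewrite nmulr_rlt0 ?ltcR // exprn_gt0 // normr_gt0.
  apply: sumr_le0 => k _; have [Dk|/Dw ->] := ltP (D 0 k) 0.
    by rewrite mulr_le0_ge0 ?exprn_ge0 // lecR ltW.
  by rewrite normr0 expr0n mulr0.
by rewrite ltxx.
Qed.

(** [card_negative_spectrum] for [H] and [- H] bounds the numbers of negative and positive
    eigenvalues. No eigenvalue is 0, so these numbers add up to [d], as the bounds do, and both
    bounds are attained. *)
Lemma index_of_bounds (H : 'M[R]_d) (I J : finType) (P : pred I) (Q : pred J)
    (ell : I -> 'cV[R]_d) (ell' : J -> 'cV[R]_d) :
  H^T = H -> H \in unitmx -> (#|P| + #|Q| = d)%N ->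
  (forall v : 'rV[R]_d, (forall i, P i -> v *m ell i = 0) ->
     0 <= (v *m H *m v^T) 0 0) ->
  (forall v : 'rV[R]_d, (forall i, Q i -> v *m ell' i = 0) ->
     (v *m H *m v^T) 0 0 <= 0) ->
  num_neg_eigenvalues H #|P|.
Proof.
move=> Hsym Hu cPQ HP HQ.
have [U [D [VU HE charH]]] := symmetric_spectral Hsym.
have UV : U *m map_mx Num.conj U^T = 1%:M by apply: mulmx1C.
have D0 i : D 0 i != 0.
  have : \det (diag_mx (toC D)) != 0.
    have -> : diag_mx (toC D) = U *m toC H *m map_mx Num.conj U^T.
      by rewrite HE !mulmxA UV mul1mx -mulmxA UV mulmx1.
    rewrite -unitfE -unitmxE !unitmx_mul map_unitmx Hu.
    by case/mulmx1_unit: UV => -> ->.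
  rewrite det_diag => /prodf_neq0/(_ i isT); rewrite mxE.
  by apply: contra_neq => ->.
have negP := card_negative_spectrum Hsym VU HE HP.
have : (#|[pred i | ((- D) 0%R i < 0)%R]| <= #|Q|)%N.
  apply: (@card_negative_spectrum (- H) U (- D) _ _ ell') => //.
  - by rewrite linearN /= Hsym.
  - have -> : diag_mx (toC (- D)) = - diag_mx (toC D) by rewrite map_mxN linearN.
    by rewrite map_mxN HE mulmxN mulNmx.
  - by move=> v /HQ; rewrite mulmxN mulNmx [X in _ -> 0 <= X]mxE oppr_ge0.
rewrite (@eq_card _ _ [predC [pred i | (D 0 i < 0)%R]]); last first.
  by move=> i; rewrite !inE mxE oppr_lt0 -leNgt lt_def D0.
move=> posQ.
have cN := cardC [pred i | (D 0 i < 0)%R]; rewrite card_ord in cN.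
exists [seq D 0 i | i <- enum 'I_d]; first by rewrite charH big_map big_enum.
have -> : count (fun a => a < 0) [seq D 0 i | i <- enum 'I_d] = #|[pred i | (D 0 i < 0)%R]|.
  by rewrite count_map -size_filter cardE enumT.
by apply/eqP; rewrite eqn_leq negP -(leq_add2r #|Q|) cPQ -[leqLHS]cN leq_add2l.
Qed.

End Index.

(** Polarisation: each entry is recovered from three values of the form. *)
Lemma quad_form_ext (R : realFieldType) (d : nat) (H K : 'M[R]_d) : H^T = H -> K^T = K ->
  (forall v : 'rV[R]_d, (v *m H *m v^T) 0 0 = (v *m K *m v^T) 0 0) -> H = K.
Proof.
move=> Hs Ks E; apply/matrixP => i j.
pose q (M : 'M[R]_d) (u w : 'rV[R]_d) : R := (u *m M *m w^T) 0 0.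
have qDl M u u' w : q M (u + u') w = q M u w + q M u' w.
  by rewrite /q !mulmxDl mxE.
have qDr M u w w' : q M u (w + w') = q M u w + q M u w'.
  by rewrite /q linearD /= !mulmxDr mxE.
have qE (M : 'M[R]_d) k l : q M (delta_mx 0 k) (delta_mx 0 l) = M k l.
  by rewrite /q -rowE trmx_delta -colE !mxE.
have P (M : 'M[R]_d) : M^T = M -> M i j =
    (q M (delta_mx 0 i + delta_mx 0 j) (delta_mx 0 i + delta_mx 0 j)
     - q M (delta_mx 0 i) (delta_mx 0 i) - q M (delta_mx 0 j) (delta_mx 0 j)) / 2.
  move=> Ms; rewrite qDl !qDr !qE.
  have -> : M j i = M i j by rewrite -{1}Ms mxE.
  by field.
by rewrite (P H) // (P K) // /q !E.
Qed.

(** * Quadratic forms in the differences of a cyclic sequence *)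

Lemma sum_ordS (V : zmodType) (n : nat) (f : 'I_n -> V) :
  \sum_(i < n) f (ordS i) = \sum_(i < n) f i.
Proof. by rewrite [RHS](reindex _ (onW_bij _ (@ordS_bij n))). Qed.

Lemma sum_ordS_sub (V : zmodType) (n : nat) (f : 'I_n -> V) :
  \sum_(i < n) (f (ordS i) - f i) = 0.
Proof. by rewrite sumrB sum_ordS subrr. Qed.

(* On sequences of sum 0 the direction [c] is in the radical of the form, and
   subtracting a multiple of it from [g] makes [g j] vanish. *)
Lemma sum_sqr_div_le0 (R : realFieldType) (n : nat) (c g : 'I_n -> R) (j : 'I_n) :
  (forall i, c i != 0) -> 0 < c j -> \sum_i c i = 0 -> \sum_i g i = 0 ->
  (forall i, 0 < c i -> i != j -> g i - c i / c j * g j = 0) ->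
  \sum_i g i ^+ 2 / c i <= 0.
Proof.
move=> c0 cj sc sg gE.
have -> : \sum_i g i ^+ 2 / c i = \sum_i (g i - c i / c j * g j) ^+ 2 / c i.
  have E i : g i ^+ 2 / c i =
     (g i - c i / c j * g j) ^+ 2 / c i + (2 * (g j / c j) * g i
       - (g j / c j) ^+ 2 * c i).
    by field; rewrite !c0.
  rewrite (eq_bigr _ (fun i _ => E i)) big_split /= sumrB -!mulr_sumr sg sc.
  by rewrite !mulr0 subr0 addr0.
apply: sumr_le0 => i _; have [ci|ci] := ltP 0 (c i); last first.
  by rewrite mulr_ge0_le0 ?sqr_ge0 // invr_le0.
have [->|ij] := eqVneq i j.
  by rewrite divff ?gt_eqF // mul1r subrr expr0n mul0r.
by rewrite gE // expr0n mul0r.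
Qed.

Lemma exists_gt0_of_sum0 (R : realFieldType) (n : nat) (c : 'I_n -> R) :
  (0 < n)%N -> (forall i, c i != 0) -> \sum_i c i = 0 -> exists i, 0 < c i.
Proof.
move=> n0 c0 sc; have [i ci|cn] := pickP (fun i => 0 < c i); first by exists i.
have cle i : c i < 0 by rewrite lt_def eq_sym c0 leNgt cn.
suff : \sum_i c i < 0 by rewrite sc ltxx.
rewrite (bigD1 (Ordinal n0)) //= -[ltRHS]addr0 ltr_leD //.
by apply: sumr_le0 => i _; exact: ltW.
Qed.

(** With N positive weights, [sum_sqr_div_le0] bounds the form on one side after N - 1 linear
    conditions for each value of [b]; replacing [c] by its opposite bounds it on the other side.
    Altogether 2 (N - 1) + 2 (n - N - 1) = 2 n - 4 conditions, as [index_of_bounds] requires. *)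
Lemma index_of_cyclic_form (R : realType) (n : nat) (c : 'I_n -> R)
    (H : 'M[R]_(2 * n - 4)) (U : bool -> 'I_n -> 'cV[R]_(2 * n - 4)) :
  (0 < n)%N -> (forall i, c i != 0) -> \sum_i c i = 0 ->
  H^T = H -> H \in unitmx ->
  (forall v : 'rV[R]_(2 * n - 4), (v *m H *m v^T) 0 0 =
    - (2^-1 * \sum_(b : bool) \sum_(i < n)
         ((v *m U b (ordS i)) 0 0 - (v *m U b i) 0 0) ^+ 2 / c i)) ->
  num_neg_eigenvalues H (2 * #|[pred i | (0 < c i)%R]| - 2) /\
  (0 < #|[pred i | (0 < c i)%R]|)%N.
Proof.
move=> n0 c0 sc Hsym Hu HE.
have [j cj] := exists_gt0_of_sum0 n0 c0 sc.
have [k ck] : exists k, 0 < - c k.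
  apply: exists_gt0_of_sum0 => // [i|]; first by rewrite oppr_eq0.
  by rewrite sumrN sc oppr0.
pose g b i : 'cV[R]_(2 * n - 4) := U b (ordS i) - U b i.
pose P (x : bool * 'I_n) := (0 < c x.2) && (x.2 != j).
pose Q (x : bool * 'I_n) := (0 < - c x.2) && (x.2 != k).
have sg b (v : 'rV[R]_(2 * n - 4)) : \sum_i (v *m g b i) 0 0 = 0.
  by rewrite -summxE -mulmx_sumr sum_ordS_sub mulmx0 mxE.
have gE b (v : 'rV[R]_(2 * n - 4)) i :
    (v *m U b (ordS i)) 0 0 - (v *m U b i) 0 0 = (v *m g b i) 0 0.
  by rewrite mulmxBr !mxE.
have cardB (p : pred 'I_n) l : p l ->
    #|[pred x : bool * 'I_n | p x.2 && (x.2 != l)]| = (2 * #|p| - 2)%N.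
  move=> pl; rewrite -sum1_card.
  rewrite -(pair_big_dep xpredT (fun _ i => p i && (i != l)) (fun _ _ => 1%N)) /=.
  rewrite big_bool /= sum1_card (cardD1 l p) unfold_in pl.
  rewrite (@eq_card _ _ [predD1 p & l]) => [|i]; last by rewrite !inE andbC.
  by rewrite addnn -mul2n mulnDr addKn.
(* Both signs occur, so the truncated subtractions in the cardinals are exact. *)
have np : (0 < #|[pred i | (0 < c i)%R]|)%N by apply/card_gt0P; exists j.
have nq : (0 < #|[pred i | (0 < - c i)%R]|)%N by apply/card_gt0P; exists k.
split => //.
rewrite -(cardB [pred i | 0 < c i] j) //.
apply: (@index_of_bounds _ _ _ _ _ P Q
   (fun x => g x.1 x.2 - (c x.2 / c j) *: g x.1 j)
   (fun x => g x.1 x.2 - (c x.2 / c k) *: g x.1 k)) => //.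
- rewrite (cardB [pred i | 0 < c i] j) // (cardB [pred i | 0 < - c i] k) //.
  have := cardC [pred i | (0 < c i)%R]; rewrite card_ord.
  rewrite (@eq_card _ [predC [pred i | (0 < c i)%R]] [pred i | (0 < - c i)%R]).
    move: #|[pred i | (0 < c i)%R]| #|[pred i | (0 < - c i)%R]| np nq => p q.
    by lia.
  by move=> i; rewrite !inE oppr_gt0 -leNgt le_eqVlt (negPf (c0 i)).
- move=> v vP; rewrite HE oppr_ge0 mulr_ge0_le0 ?invr_ge0 ?ler0n //.
  apply: sumr_le0 => b _; under eq_bigr do rewrite gE.
  apply: (@sum_sqr_div_le0 _ _ _ _ j) => // i ci ij.
  have /matrixP/(_ 0 0) := vP (b, i) (introT andP (conj ci ij)).
  by rewrite mulmxBr -scalemxAr !mxE.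
- move=> v vQ; rewrite HE oppr_le0 mulr_ge0 ?invr_ge0 ?ler0n //.
  apply: sumr_ge0 => b _; under eq_bigr do rewrite gE.
  rewrite -oppr_le0 -sumrN.
  under eq_bigr do rewrite -mulrN -invrN.
  apply: (@sum_sqr_div_le0 _ _ (fun i => - c i) _ k) => //.
  + by move=> i; rewrite oppr_eq0.
  + by rewrite sumrN sc oppr0.
  + move=> i ci ij.
    have /matrixP/(_ 0 0) := vQ (b, i) (introT andP (conj ci ij)).
    by rewrite mulmxBr -scalemxAr !mxE invrN mulrNN.
Qed.

(** * Angles modulo full turns *)

(** The left side represents the angle 2 a between - pi and pi. As 2 a lies between - 2 pi and 2 pi,
    at most one turn is to be corrected, precisely when [a] and the sine of 2 a have opposite
    signs. *)
Lemma acos_cos_lift (R : realType) (a : R) : - pi < a < pi -> sin (a *+ 2) != 0 ->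
  Num.sg (sin (a *+ 2)) * acos (cos (a *+ 2)) =
  a *+ 2 + 2 * pi * ((0 < sin (a *+ 2))%R%:R - (0 < a)%R%:R).
Proof.
(* Both sides are odd in [a]. *)
wlog a0 : a / 0 < a.
  move=> H api s0; have [a0|a0|a0] := ltgtP a 0; last first.
  - by rewrite a0 mul0rn sin0 eqxx in s0.
  - by rewrite H // a0.
  have s0' : sin (- a *+ 2) != 0 by rewrite mulNrn sinN oppr_eq0.
  have apiN : - pi < - a < pi by move: api; rewrite !ltrN2 ltrNl andbC.
  have := H (- a) _ apiN s0'; rewrite oppr_gt0 a0 => /(_ isT).
  rewrite mulNrn sinN cosN sgrN oppr_gt0 => E.
  rewrite -[LHS]opprK -mulNr E.
  have [s1|s1|s1] := ltgtP (sin (a *+ 2)) 0; rewrite ?mulr1n ?mulr0n; try lra.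
move=> /andP[_ api] s0; rewrite a0.
have pi0 : (0 : R) < pi := pi_gt0 R.
have ht2 : a *+ 2 = a + a by rewrite mulr2n.
have [s1|s1|s1] := ltgtP (sin (a *+ 2)) 0; last by rewrite s1 eqxx in s0.
- rewrite ltr0_sg // mulN1r.
  have ha : pi <= a *+ 2.
    rewrite leNgt; apply/negP => lt; move: s1; apply/negP; rewrite -leNgt.
    by apply: sin_ge0_pi; rewrite ht2; lra.
  have -> : cos (a *+ 2) = cos (pi *+ 2 - a *+ 2).
    by rewrite -[RHS]cosN opprB -[in LHS](subrK (pi *+ 2) (a *+ 2)) cosD2pi.
  rewrite cosK ?in_itv /=; first by rewrite mulr0n mulr1n; lra.
  by rewrite ht2 in ha *; rewrite mulr2n; lra.
- rewrite gtr0_sg // mul1r.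
  have ha : a *+ 2 < pi.
    rewrite ltNge; apply/negP => lt; move: s1; apply/negP; rewrite -leNgt.
    rewrite -[a *+ 2](subrK pi) sinDpi oppr_le0.
    by apply: sin_ge0_pi; rewrite ht2 in lt *; lra.
  rewrite cosK ?in_itv /=; first by rewrite !mulr1n; lra.
  by rewrite ht2 in ha *; lra.
Qed.

Lemma cos_2atan (R : realType) (t : R) : cos (atan t *+ 2) = (1 - t ^+ 2) / (1 + t ^+ 2).
Proof.
have p : 0 < 1 + t ^+ 2 by rewrite ltr_pwDl ?sqr_ge0.
rewrite cos_mulr2n cos_atan exprVn sqr_sqrtr ?ltW //; field.
by rewrite gt_eqF.
Qed.

Lemma sin_2atan (R : realType) (t : R) : sin (atan t *+ 2) = 2 * t / (1 + t ^+ 2).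
Proof.
have p : 0 < 1 + t ^+ 2 by rewrite ltr_pwDl ?sqr_ge0.
have c0 : cos (atan t) != 0 by rewrite gt_eqF // cos_gt0_pihalf // atan_gtNpi2 atan_ltpi2.
have st : sin (atan t) = t * cos (atan t).
  by rewrite -{2}(atanK t) /tan divfK.
rewrite sin_mulr2n st mulrCA -expr2 cos_atan exprVn sqr_sqrtr ?ltW //; field.
by rewrite gt_eqF.
Qed.

Lemma sum3E (V : zmodType) (f : 'I_3 -> V) : \sum_i f i = f 0 + f 1 + f 2.
Proof.
rewrite !big_ord_recl big_ord0 addr0 addrA.
by congr (_ + f _ + f _); apply: val_inj.
Qed.

Lemma ord3P (i : 'I_3) : [\/ i = 0, i = 1 | i = 2].
Proof.
case: i => [[|[|[|i]]] //= hi].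
- by apply: Or31; apply: val_inj.
- by apply: Or32; apply: val_inj.
- by apply: Or33; apply: val_inj.
Qed.

(** * Isometries of R^3 *)

Section Euclid.
Variable R : realType.
Implicit Types (u v w : 'rV[R]_3) (A : 'M[R]_3).

Lemma dotE u v : dot u v = u 0 0 * v 0 0 + u 0 1 * v 0 1 + u 0 2 * v 0 2.
Proof. exact: sum3E. Qed.

Lemma dot_mx u v : dot u v = (u *m v^T) 0 0.
Proof. by rewrite mxE; apply: eq_bigr => k _; rewrite mxE. Qed.

Lemma crossE u v : (cross u v 0 0 = u 0 1 * v 0 2 - u 0 2 * v 0 1) *
  (cross u v 0 1 = u 0 2 * v 0 0 - u 0 0 * v 0 2) *
  (cross u v 0 2 = u 0 0 * v 0 1 - u 0 1 * v 0 0).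
Proof.
have o0 : ordS (0 : 'I_3) = 1 by apply: val_inj.
have o1 : ordS (1 : 'I_3) = 2 by apply: val_inj.
have o2 : ordS (2 : 'I_3) = 0 by apply: val_inj.
by split; [split|]; rewrite mxE ?o0 ?o1 ?o2 ?o0.
Qed.

Lemma dot_rot A u v : A *m A^T = 1%:M -> dot (u *m A) (v *m A) = dot u v.
Proof. by move=> AA; rewrite !dot_mx trmx_mul mulmxA -(mulmxA u) AA mulmx1. Qed.

Definition rows3 u v w : 'M[R]_3 :=
  \matrix_(i < 3) (if i == 0 then u else if i == 1 then v else w).

Lemma det3E (M : 'M[R]_3) :
  \det M = M 0 0 * (M 1 1 * M 2 2 - M 1 2 * M 2 1)
         - M 0 1 * (M 1 0 * M 2 2 - M 1 2 * M 2 0)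
         + M 0 2 * (M 1 0 * M 2 1 - M 1 1 * M 2 0).
Proof.
have det2 (N : 'M[R]_2) : \det N = N 0 0 * N 1 1 - N 0 1 * N 1 0.
  rewrite (expand_det_row _ 0) !big_ord_recl big_ord0 addr0 /cofactor !det_mx11 !mxE.
  rewrite /= expr0 expr1 mul1r mulN1r mulrN.
  by congr (N _ _ * N _ _ - N _ _ * N _ _); apply: val_inj.
rewrite (expand_det_row _ 0) sum3E /cofactor !det2 !mxE /= expr0 expr1 sqrrN expr1n.
rewrite !mul1r mulN1r mulrN.
by congr (_ * (M _ _ * M _ _ - M _ _ * M _ _) - _ * (M _ _ * M _ _ - M _ _ * M _ _) +
   _ * (M _ _ * M _ _ - M _ _ * M _ _)); apply: val_inj.
Qed.

Lemma det_rows3 u v w : \det (rows3 u v w) = dot (cross u v) w.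
Proof. by rewrite det3E !mxE /= dotE !crossE; ring. Qed.

Lemma rows3M u v w A : rows3 u v w *m A = rows3 (u *m A) (v *m A) (w *m A).
Proof.
apply/row_matrixP => i; rewrite row_mul !rowK.
by case: (i == 0) => //; case: (i == 1).
Qed.

Lemma dot_cross_rot A u v w : \det A = 1 ->
  dot (cross (u *m A) (v *m A)) (w *m A) = dot (cross u v) w.
Proof. by move=> dA; rewrite -!det_rows3 -rows3M det_mulmx dA mulr1. Qed.

(** Pairing with the basis vectors reduces this to triple products, which are determinants and so
    are preserved when [\det A = 1]. *)
Lemma cross_rot A u v : A *m A^T = 1%:M -> \det A = 1 ->
  cross (u *m A) (v *m A) = cross u v *m A.
Proof.
move=> AA dA; have A'A := mulmx1C AA.
apply/rowP => k.
have dk w : dot w (delta_mx 0 k) = w 0 k.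
  by rewrite dot_mx trmx_delta -colE mxE.
have eA : delta_mx 0 k = delta_mx 0 k *m A^T *m A :> 'rV[R]_3.
  by rewrite -mulmxA A'A mulmx1.
by rewrite -!dk eA dot_cross_rot // dot_rot.
Qed.

Lemma enorm_rot A u : A *m A^T = 1%:M -> enorm (u *m A) = enorm u.
Proof. by move=> AA; rewrite /enorm dot_rot. Qed.

Lemma enorm_sqr u : enorm u ^+ 2 = dot u u.
Proof. by rewrite sqr_sqrtr // dotE -!expr2 !addr_ge0 // sqr_ge0. Qed.

End Euclid.

Section Isometries.
Variables (R : realType) (n : nat).
Implicit Types (x y z : config R n) (A : 'M[R]_3) (b : 'rV[R]_3).

Definition motion A b x : config R n :=
  (x.1 *m A + \matrix_(i < n) b, x.2 *m A).

Lemma row_motion A b x i : row i (motion A b x).1 = row i x.1 *m A + b.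
Proof. by rewrite linearD /= row_mul rowK. Qed.

Lemma isometricP x y :
  isometric x y <-> exists A b, [/\ A *m A^T = 1%:M, \det A = 1 & y = motion A b x].
Proof.
split=> [[A [b [AA dA E1 E2]]]|[A [b [AA dA ->]]]]; exists A, b; last first.
  by split => // i; exact: row_motion.
split => //; apply: injective_projections => //=.
by apply/row_matrixP => i; rewrite E1 row_motion.
Qed.

Lemma motion_comp A b A' b' x :
  motion A' b' (motion A b x) = motion (A *m A') (b *m A' + b') x.
Proof.
apply: injective_projections; rewrite /= ?mulmxA //.
apply/row_matrixP => i; rewrite !linearD /= !row_mul !linearD /= row_mul !rowK.
by rewrite mulmxDl -mulmxA addrA.
Qed.

Lemma motion1 x : motion 1%:M 0 x = x.
Proof.
apply: injective_projections; rewrite /= ?mulmx1 //.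
by apply/matrixP => i j; rewrite !mxE addr0.
Qed.

Lemma motionK A b : A *m A^T = 1%:M -> cancel (motion A b) (motion A^T (- (b *m A^T))).
Proof. by move=> AA x; rewrite motion_comp AA addrN motion1. Qed.

Lemma isometric_motion A b x : A *m A^T = 1%:M -> \det A = 1 ->
  isometric x (motion A b x).
Proof. by move=> AA dA; apply/isometricP; exists A, b. Qed.

Lemma isometric_refl x : isometric x x.
Proof. by rewrite -{2}(motion1 x); apply: isometric_motion; rewrite ?trmx1 ?mulmx1 ?det1. Qed.

Lemma isometric_trans x y z : isometric x y -> isometric y z -> isometric x z.
Proof.
move=> /isometricP[A [b [AA dA ->]]] /isometricP[A' [b' [AA' dA' ->]]].
rewrite motion_comp; apply: isometric_motion; last by rewrite det_mulmx dA dA' mulr1.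
by rewrite trmx_mul mulmxA -(mulmxA A) AA' mulmx1.
Qed.

Lemma isometric_sym x y : isometric x y -> isometric y x.
Proof.
move=> /isometricP[A [b [AA dA ->]]].
apply/isometricP; exists A^T, (- (b *m A^T)).
by rewrite trmxK det_tr dA (mulmx1C AA) motionK.
Qed.

Lemma iso_classP x y : iso_class x = iso_class y <-> isometric x y.
Proof.
split=> [E|xy]; first by have : iso_class y y := isometric_refl y; rewrite -E.
apply/seteqP; split => z /= h; first exact: isometric_trans (isometric_sym xy) h.
exact: isometric_trans xy h.
Qed.

Lemma decorated_isometric (L : 'I_n -> R) x y :
  isometric x y -> decorated L x -> decorated L y.
Proof.
move=> /isometricP[A [b [AA dA ->]]] [xL x1]; split; last by rewrite enorm_rot.
by move=> i; rewrite !row_motion opprD addrACA subrr addr0 -mulmxBl enorm_rot.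
Qed.

Lemma crossDl u v w : cross (u + v) w = cross u w + cross v w :> 'rV[R]_3.
Proof. by apply/rowP => k; rewrite !mxE; ring. Qed.

Lemma crossC u v : cross u v = - cross v u :> 'rV[R]_3.
Proof. by apply/rowP => k; rewrite !mxE; ring. Qed.

Lemma crossDr u v w : cross w (u + v) = cross w u + cross w v :> 'rV[R]_3.
Proof. by rewrite crossC crossDl opprD -!(crossC w). Qed.

Lemma crossvv u : cross u u = 0 :> 'rV[R]_3.
Proof. by apply/rowP => k; rewrite !mxE; ring. Qed.

Lemma vector_area_isometric x y : isometric x y -> vector_area x = vector_area y.
Proof.
move=> /isometricP[A [b [AA dA ->]]]; rewrite /vector_area.
(* The translation contributes [cross b] of differences of consecutive rotated vertices, which
   telescope around the polygon. *)
rewrite [in RHS](eq_bigr (fun i => cross (row i x.1) (row (ordS i) x.1) *m A +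
   (cross b (row (ordS i) x.1 *m A) - cross b (row i x.1 *m A)))); last first.
  move=> i _; rewrite !row_motion crossDl !crossDr crossvv addr0 cross_rot //.
  by rewrite (crossC (row i x.1 *m A) b); rewrite -addrA; congr (_ + _); rewrite addrC.
rewrite big_split /= sumrB (sum_ordS (fun i => cross b (row i x.1 *m A))).
by rewrite subrr addr0 -mulmx_suml dot_rot.
Qed.

Lemma moduli_area_iso_class x : @moduli_area R n (iso_class x) = vector_area x.
Proof.
apply: esym; apply: vector_area_isometric.
by apply: (@getPex _ (iso_class x)); exists x; exact: isometric_refl.
Qed.

End Isometries.

(** * Second order expansions and changes of charts *)

Section Jets.
Variables (R : realType) (V : normedModType R).
Implicit Types (f g h : V -> R) (v w : V).

Lemma near_interior (P : V -> Prop) :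
  (\forall x \near (0 : V), P x) -> \forall x \near (0 : V), \forall y \near x, P y.
Proof. by move=> /nbhs_interior. Qed.

(** A pointwise weakening of C^2 at 0, stable under sums and products and sufficient for the Leibniz
    rule for Hessians. *)
Definition jet2 f :=
  (\forall x \near (0 : V), differentiable f x) /\
  forall w, differentiable ('D_w f) (0 : V).

Lemma near_eq_differentiable (W : normedModType R) (f g : V -> W) x :
  {near x, f =1 g} -> differentiable f x -> differentiable g x.
Proof.
move=> fg df.
have E : g \o shift x = cst (g x) + 'd f x +o_ (0 : V) id.
  apply/eqaddoP => e e0; have := diff_locally df.
  move=> /eqaddoP/(_ e e0); rewrite -(nbhs_singleton fg).
  apply: filter_app.
  have : \forall y \near (0 : V), f (y + x) = g (y + x).
    by move: fg; rewrite (near_shift 0 x) /= subr0.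
  apply: filterS => y.
  by rewrite /= -![(_ - _) y]/(_ y - _ y) /= => ->.
have dE := diff_unique (diff_continuous df) E.
by apply/diff_locallyP; rewrite dE; split => //; exact: diff_continuous.
Qed.

Lemma near_eq_jet2 f g : {near (0 : V), f =1 g} -> jet2 f -> jet2 g.
Proof.
move=> /near_interior fg [df ddf]; split.
  by near=> x; apply: near_eq_differentiable (near fg x _) (near df x _).
move=> w; apply: near_eq_differentiable (ddf w).
by near=> x; apply: near_eq_derive; near: x.
Unshelve. all: by end_near. Qed.

Lemma jet2_cst (a : R) : jet2 (cst a).
Proof.
split; first by near=> x; exact: differentiable_cst.
move=> w; rewrite (_ : 'D_w (cst a) = cst 0); last first.
  by apply/funext => x; rewrite derive_cst.
exact: differentiable_cst.
Unshelve. all: by end_near. Qed.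

Lemma jet2D f g : jet2 f -> jet2 g -> jet2 (f \+ g).
Proof.
move=> [df ddf] [dg ddg]; split.
  by near=> x; apply: differentiableD; [near: x|near: x].
move=> w; apply: (@near_eq_differentiable _ ('D_w f + 'D_w g)).
  near=> x; rewrite deriveD //; apply: diff_derivable; by near: x.
exact: differentiableD.
Unshelve. all: by end_near. Qed.

Lemma jet2M f g : jet2 f -> jet2 g -> jet2 (f \* g).
Proof.
move=> [df ddf] [dg ddg]; split.
  by near=> x; apply: differentiableM; [near: x|near: x].
move=> w; apply: (@near_eq_differentiable _ (f * 'D_w g + g * 'D_w f)).
  near=> x; rewrite deriveM //; apply: diff_derivable; by near: x.
by apply: differentiableD; apply: differentiableM => //; [move: df|move: dg] => /nbhs_singleton.
Unshelve. all: by end_near. Qed.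

Lemma jet2_sum (I : finType) (f : I -> V -> R) :
  (forall i, jet2 (f i)) -> jet2 (fun x => \sum_i f i x).
Proof.
move=> df; rewrite (_ : (fun x => _) = \sum_i f i); last first.
  by apply/funext => x; rewrite fct_sumE.
elim/big_ind : _ => //; first exact: (jet2_cst 0).
by move=> ? ? ? ?; exact: jet2D.
Qed.

End Jets.

Section SecondOrder.
Variables (R : realType) (d : nat).
Local Notation V := 'rV[R]_d.
Implicit Types (f g h : V -> R) (H : 'M[R]_d) (v w : V).

Definition grad f : 'cV[R]_d := \col_i 'D_(delta_mx 0 i) f 0.

Lemma derive_grad f v : differentiable f 0 -> 'D_v f 0 = (v *m grad f) 0 0.
Proof.
move=> df; rewrite deriveE // mxE {1}(row_sum_delta v) linear_sum.
by apply: eq_bigr => i _; rewrite linearZ mxE deriveE.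
Qed.

Lemma gradD f g : differentiable f 0 -> differentiable g 0 ->
  grad (f \+ g) = grad f + grad g.
Proof.
by move=> df dg; apply/colP => i; rewrite !mxE deriveD //; exact: diff_derivable.
Qed.

Lemma gradM f g : differentiable f 0 -> differentiable g 0 ->
  grad (f \* g) = f 0 *: grad g + g 0 *: grad f.
Proof.
by move=> df dg; apply/colP => i; rewrite !mxE deriveM //; exact: diff_derivable.
Qed.

Lemma grad_cst a : grad (cst a) = 0.
Proof. by apply/colP => i; rewrite !mxE derive_cst. Qed.

Lemma near_eq_grad f g : {near (0 : V), f =1 g} -> grad f = grad g.
Proof. by move=> fg; apply/colP => i; rewrite !mxE; exact: near_eq_derive. Qed.

Lemma hessianE g x i j :
  hessian g x i j = 'D_(delta_mx 0 i) ('D_(delta_mx 0 j) g) x.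
Proof. exact: mxE. Qed.

Lemma outerE f g i j :
  (grad f *m (grad g)^T) i j = 'D_(delta_mx 0 i) f 0 * 'D_(delta_mx 0 j) g 0.
Proof. by rewrite mxE big_ord1 [_^T _ _]mxE [X in X * _]mxE [X in _ * X]mxE. Qed.

Lemma outer11 (x y : 'M[R]_1) : (x *m y^T) 0 0 = x 0 0 * y 0 0.
Proof. by rewrite mxE big_ord1 [_^T _ _]mxE. Qed.

(* The last clause determines [H] by first derivatives of curves only, so that
   Hessians can be compared along a change of charts which is merely
   differentiable. *)
Definition qjet g H :=
  [/\ jet2 g, hessian g 0 = H &
   forall (c : R -> V), differentiable c 0 -> c 0 = 0 ->
     let v := 'D_1 c 0 in
     t^-1 * (t^-1 * (g (c t) - g 0)) @[t --> 0^'] --> (v *m H *m v^T) 0 0 / 2].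

Lemma leibniz_aux (a b x y p q p' q' : R) : a = 0 -> b = 0 ->
  (a * x + p * q) + (b * y + p' * q') = q * p + p' * q'.
Proof. by move=> -> ->; ring. Qed.

(** Both factors vanish at 0, so second derivatives of either factor drop out of the Leibniz rule,
    and along a curve the second difference quotient is a product of two first ones. *)
Lemma qjetM f h : jet2 f -> jet2 h -> f 0 = 0 -> h 0 = 0 ->
  qjet (f \* h) (grad f *m (grad h)^T + grad h *m (grad f)^T).
Proof.
move=> jf jh f0 h0; have [df ddf] := jf; have [dh ddh] := jh.
have df0 := nbhs_singleton df; have dh0 := nbhs_singleton dh.
split; first exact: jet2M.
  apply/matrixP => i j; rewrite hessianE mxE !outerE.
  set v := delta_mx 0 i; set w := delta_mx 0 j.
  rewrite (@near_eq_derive _ _ _ _ (f * 'D_w h + h * 'D_w f)); last first.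
    near=> x; rewrite deriveM //; apply: diff_derivable; by near: x.
  rewrite deriveD; try exact/diff_derivable/differentiableM.
  have E1 : 'D_v (f * 'D_w h) 0 = f 0 * 'D_v ('D_w h) 0 + 'D_w h 0 * 'D_v f 0.
    by apply: deriveM; exact: diff_derivable.
  have E2 : 'D_v (h * 'D_w f) 0 = h 0 * 'D_v ('D_w f) 0 + 'D_w f 0 * 'D_v h 0.
    by apply: deriveM; exact: diff_derivable.
  rewrite E1 E2 [X in _ = _ + X]mulrC; exact: leibniz_aux.
move=> c dc c0 v.
have cv g : differentiable g 0 -> g 0 = 0 ->
    t^-1 * g (c t) @[t --> 0^'] --> (v *m grad g) 0 0.
  move=> dg g0.
  have dgc : differentiable (g \o c) (0 : R).
    by apply: differentiable_comp => //; rewrite c0.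
  have <- : 'D_1 (g \o c) 0 = (v *m grad g) 0 0.
    rewrite (deriveE _ dgc) diff_comp ?c0 //.
    by rewrite -derive_grad // (deriveE _ dg) /v (deriveE _ dc).
  have E : (fun t : R => t^-1 *: ((g \o c \o shift 0) (t *: 1) - (g \o c) 0)) =
      (fun t => t^-1 * g (c t)).
    by apply/funext => t; rewrite /= c0 g0 subr0 addr0 [_ *: 1]mulr1.
  have : derivable (g \o c) 0 1 by exact: diff_derivable.
  by rewrite /derivable /derive E.
rewrite (_ : _ / 2 = (v *m grad f) 0 0 * (v *m grad h) 0 0); last first.
  rewrite mulmxDr mulmxDl !mulmxA -!(mulmxA (v *m _)) -!trmx_mul.
  by rewrite mxE !outer11; field.
rewrite (_ : (fun t => _) = (fun t => (t^-1 * f (c t)) * (t^-1 * h (c t)))); last first.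
  by apply/funext => t /=; rewrite f0; ring.
by apply: cvgM; exact: cv.
Unshelve. all: by end_near. Qed.

Lemma qjetD f g H K : qjet f H -> qjet g K -> qjet (f \+ g) (H + K).
Proof.
move=> [jf hf cf] [jg hg cg]; split; first exact: jet2D.
  apply/matrixP => i j.
  transitivity (hessian f 0 i j + hessian g 0 i j); last first.
    by rewrite hf hg [RHS]mxE.
  apply: (etrans (hessianE _ 0 i j)).
  apply: (etrans _ (esym (congr2 +%R (hessianE f 0 i j) (hessianE g 0 i j)))).
  set v := delta_mx 0 i; set w := delta_mx 0 j.
  have [df ddf] := jf; have [dg ddg] := jg.
  rewrite (@near_eq_derive _ _ _ _ ('D_w f + 'D_w g)); last first.
    near=> x; rewrite deriveD //; apply: diff_derivable; by near: x.
  by rewrite deriveD //; exact: diff_derivable.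
move=> c dc c0 v; rewrite mulmxDr mulmxDl mxE mulrDl.
rewrite (_ : (fun t => _) = (fun t =>
    t^-1 * (t^-1 * (f (c t) - f 0)) + t^-1 * (t^-1 * (g (c t) - g 0)))).
  by apply: cvgD; [exact: cf|exact: cg].
by apply/funext => t /=; rewrite -!mulrDr opprD addrACA.
Unshelve. all: by end_near. Qed.

Lemma qjet_cst (a : R) : qjet (cst a) 0.
Proof.
split; first exact: jet2_cst.
  apply/matrixP => i j; rewrite (hessianE (cst a)) [RHS]mxE.
  rewrite (_ : (fun y => _) = cst 0); first by rewrite derive_cst.
  by apply/funext => y; rewrite derive_cst.
move=> c dc c0 v; rewrite mulmx0 mul0mx mxE mul0r /=.
by under eq_fun do rewrite subrr !mulr0; exact: cvg_cst.
Qed.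

Lemma near_eq_qjet f g H : {near (0 : V), g =1 f} -> qjet f H -> qjet g H.
Proof.
move=> fg [jf hf cf]; split.
    by apply: near_eq_jet2 jf; move: fg; apply: filterS => x ->.
  have fg2 := near_interior fg.
  rewrite -hf; apply/matrixP => i j; apply: (etrans (hessianE g 0 i j)).
  apply: (etrans _ (esym (hessianE f 0 i j))); apply: near_eq_derive.
  near=> x; apply: near_eq_derive.
  by near: x.
move=> c dc c0 v; apply: cvg_trans (cf c dc c0); apply: near_eq_cvg.
have g0 := nbhs_singleton fg; have : \forall t \near (0 : R), g (c t) = f (c t).
  have cc : c t @[t --> (0 : R)] --> (0 : V).
    by rewrite -c0; exact: differentiable_continuous.
  exact: cc fg.
move=> h; apply: nbhs_dnbhs; move: h; apply: filterS => t -> //; rewrite g0.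
Unshelve. all: by end_near. Qed.

End SecondOrder.

(** * Coordinate functions on configurations *)

Lemma differentiable_mx (R : realType) (V : normedModType R) (m p : nat)
    (f : V -> 'M[R]_(m, p)) (x : V) :
  (forall i k, differentiable (fun y => f y i k) x) -> differentiable f x.
Proof.
move=> df.
rewrite (_ : f = \sum_(i < m) \sum_(k < p) fun y => f y i k *: delta_mx i k).
  apply: differentiable_sum => i; apply: differentiable_sum => k.
  exact: differentiableZl.
apply/funext => y; rewrite {1}(matrix_sum_delta (f y)) fct_sumE.
by apply: eq_bigr => i _; rewrite fct_sumE.
Qed.

Section Coordinates.
Variables (R : realType) (n : nat).

Lemma vertex_coordinate i k : exists2 l : {linear config R n -> R},
  continuous l & forall x, l x = x.1 i k.
Proof.
have lin : linear (fun x : config R n => x.1 i k : R).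
  by move=> a x y; rewrite /= !mxE.
pose M := GRing.isLinear.Build R (config R n) R *:%R _ lin.
pose l : {linear config R n -> R} := HB.pack (fun x : config R n => x.1 i k : R) M.
exists l => // x.
apply: (@continuous_comp _ _ _ (@fst _ _) (fun N : 'M[R]_(n, 3) => N i k)).
  exact: cvg_fst.
exact: coord_continuous.
Qed.

Lemma normal_coordinate k : exists2 l : {linear config R n -> R},
  continuous l & forall x, l x = x.2 0 k.
Proof.
have lin : linear (fun x : config R n => x.2 0 k : R).
  by move=> a x y; rewrite /= !mxE.
pose M := GRing.isLinear.Build R (config R n) R *:%R _ lin.
pose l : {linear config R n -> R} := HB.pack (fun x : config R n => x.2 0 k : R) M.
exists l => // x.
apply: (@continuous_comp _ _ _ (@snd _ _) (fun N : 'rV[R]_3 => N 0 k)).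
  exact: cvg_snd.
exact: coord_continuous.
Qed.

(** Directional derivatives commute with the continuous linear [l], so the C^2 part of the
    smoothness of [phi] is enough. *)
Lemma jet2_linear (V : normedModType R) (U : set V) (l : {linear config R n -> R})
    (phi : V -> config R n) :
  continuous l -> open U -> U 0 -> smooth_on U phi -> jet2 (l \o phi).
Proof.
move=> cl Uo U0 phis; have [dphi ddphi] := phis 2%N.
have nU : \forall x \near (0 : V), U x by exact: open_nbhs_nbhs.
have dl y : differentiable l y by exact: linear_differentiable.
split; first by near=> x; apply: differentiable_comp => //; apply: dphi; near: x.
move=> w; apply: (@near_eq_differentiable _ _ _ (l \o (fun x => 'D_w phi x))).
  near=> x; have Ux : U x by near: x.
  have dx := dphi x Ux.
  rewrite [RHS]deriveE; last exact: differentiable_comp.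
  by rewrite diff_comp // diff_lin //= deriveE.
by apply: differentiable_comp => //; case: (ddphi w) => + _; apply.
Unshelve. all: by end_near. Qed.

Lemma differentiable_motion A b (x : config R n) : differentiable (@motion R n A b) x.
Proof.
apply: differentiable_pair; apply: differentiable_mx => i k.
  have -> : (fun y : config R n => (y.1 *m A + \matrix_(_ < n) b) i k) =
     \sum_(l < 3) (fun y : config R n => A l k *: y.1 i l) + cst (b 0 k).
    apply/funext => y; rewrite !mxE fct_sumE; congr (_ + _).
    by apply: eq_bigr => l _; rewrite -[_ *: _]/(_ * _) mulrC.
  apply: differentiableD; last exact: differentiable_cst.
  apply: differentiable_sum => l; apply: differentiableZ.
  have [c cc /funext <-] := vertex_coordinate i l; exact: linear_differentiable.
have -> : (fun y : config R n => (y.2 *m A) i k) =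
     \sum_(l < 3) (fun y : config R n => A l k *: y.2 i l).
  apply/funext => y; rewrite !mxE fct_sumE.
  by apply: eq_bigr => l _; rewrite -[_ *: _]/(_ * _) mulrC.
apply: differentiable_sum => l; apply: differentiableZ; rewrite !ord1.
have [c cc /funext <-] := normal_coordinate l; exact: linear_differentiable.
Qed.

End Coordinates.

Section Charts.
Variables (R : realType) (n : nat) (L : 'I_n -> R).
Local Notation d := (moduli_dim n).
Implicit Types (phi : 'rV[R]_d -> config R n) (X : set (config R n)).

Lemma chart_change X phi psi : local_param L X phi -> local_param L X psi ->
  exists tau : 'rV[R]_d -> 'rV[R]_d,
    [/\ differentiable tau (0 : 'rV[R]_d), tau 0 = 0 &
        \forall u \near (0 : 'rV[R]_d), isometric (phi (tau u)) (psi u)].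
Proof.
move=> [c [U [W [[_ Uo U0 phiX _] [Wo cs phiU cW retr]]]]].
move=> [c' [U' [W' [[_ U'o U'0 psiX psis] [_ _ psiU _ _]]]]].
have /iso_classP/isometricP[A [b [AA dA E0]]] : iso_class (psi 0) = iso_class (phi 0).
  by rewrite phiX psiX.
pose E := @motion R n A b.
have [dphi0 W0 c0] := phiU 0 U0.
have dE : differentiable (E \o psi) 0.
  apply: differentiable_comp; last exact: differentiable_motion.
  by have [+ _] := psis 1%N; apply.
have dc : differentiable c (phi 0).
  by have [+ _] := cs 1%N; apply.
(* The motion [E] carries [psi 0] to [phi 0] itself, since [W] is only known to be a neighbourhood
   of that representative. *)
exists (c \o (E \o psi)); split; last 1 first.
- have WE : \forall u \near (0 : 'rV[R]_d), W ((E \o psi) u).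
    apply: (differentiable_continuous dE); rewrite /= /E -E0.
    exact: open_nbhs_nbhs.
  have U'n : \forall u \near (0 : 'rV[R]_d), U' u by exact: open_nbhs_nbhs.
  near=> u.
  have Uu : U' u by near: u.
  have Wu : W ((E \o psi) u) by near: u.
  have [du _ _] := psiU u Uu.
  have iE : isometric (psi u) ((E \o psi) u) by exact: isometric_motion.
  have [_ h] := retr _ (decorated_isometric iE du) Wu.
  exact: isometric_trans h (isometric_sym iE).
- by apply: differentiable_comp; rewrite //= /E -E0.
- by rewrite /= /E -E0.
Unshelve. all: by end_near. Qed.

Lemma local_param_inj X phi : local_param L X phi ->
  exists2 U : set 'rV[R]_d, open U /\ U 0 &
  forall a b, U a -> U b -> isometric (phi a) (phi b) -> a = b.
Proof.
move=> [c [U [W [[_ Uo U0 _ _] [_ _ phiU cW _]]]]]; exists U => // a b Ua Ub ab.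
have [da Wa <-] := phiU a Ua; have [db Wb <-] := phiU b Ub.
by apply: cW.
Qed.

(** Near 0 the composite of [tau'] and [tau] moves no point to a different class, so it is the
    identity by injectivity of [phi] on classes; the chain rule then makes the Jacobians inverse to
    each other. *)
Lemma chart_change_unit X phi psi (tau tau' : 'rV[R]_d -> 'rV[R]_d) :
  local_param L X phi ->
  differentiable tau (0 : 'rV[R]_d) -> tau 0 = 0 ->
  differentiable tau' (0 : 'rV[R]_d) -> tau' 0 = 0 ->
  (\forall u \near (0 : 'rV[R]_d), isometric (phi (tau u)) (psi u)) ->
  (\forall u \near (0 : 'rV[R]_d), isometric (psi (tau' u)) (phi u)) ->
  jacobian tau 0 \in unitmx.
Proof.
move=> /local_param_inj[U [Uo U0] Uinj] dt t0 dt' t0' h h'.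
have ct : \forall u \near (0 : 'rV[R]_d), U (tau (tau' u)).
  have dd : differentiable (tau \o tau') 0.
    by apply: differentiable_comp; rewrite ?t0'.
  apply: (differentiable_continuous dd); rewrite /= t0' t0.
  exact: open_nbhs_nbhs.
have Un : \forall u \near (0 : 'rV[R]_d), U u by exact: open_nbhs_nbhs.
have ht' : \forall u \near (0 : 'rV[R]_d), isometric (phi (tau (tau' u))) (psi (tau' u)).
  have ct' : tau' u @[u --> (0 : 'rV[R]_d)] --> (0 : 'rV[R]_d).
    by rewrite -[X in _ --> X]t0'; exact: differentiable_continuous.
  exact: ct' h.
have E : \forall u \near (0 : 'rV[R]_d), u = (tau \o tau') u.
  near=> u; apply: Uinj; [by near: u|by near: u|].
  have h1 : isometric (phi (tau (tau' u))) (psi (tau' u)) by near: u.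
  have h2 : isometric (psi (tau' u)) (phi u) by near: u.
  exact/isometric_sym/(isometric_trans h1).
have J (v : 'rV[R]_d) : v *m (jacobian tau' 0 *m jacobian tau 0) = v.
  rewrite mulmxA -deriveEjacobian // -deriveEjacobian // (deriveE _ dt') (deriveE _ dt).
  have dtt : differentiable (tau \o tau') 0.
    by apply: differentiable_comp; rewrite ?t0'.
  have := diff_comp dt' _; rewrite t0' => /(_ _ tau dt)/(congr1 (@^~ v)) /= <-.
  rewrite -deriveE // -[RHS](derive_id (0 : 'rV[R]_d)).
  apply: near_eq_derive; move: E; apply: filterS => u {2}-> //.
have /mulmx1_unit[] // : jacobian tau' 0 *m jacobian tau 0 = 1%:M.
by apply/row_matrixP => i; rewrite !rowE J mulmx1.
Unshelve. all: by end_near. Qed.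

(** The second difference quotients along a line [t *: v] and along its image under [tau] coincide
    near 0, hence so do their limits; polarisation concludes. *)
Lemma hessian_transfer (d : nat) (g h : 'rV[R]_d -> R) (H K : 'M[R]_d)
    (tau : 'rV[R]_d -> 'rV[R]_d) :
  H^T = H -> K^T = K -> qjet g H -> qjet h K ->
  differentiable tau (0 : 'rV[R]_d) -> tau 0 = 0 ->
  (\forall u \near (0 : 'rV[R]_d), g (tau u) = h u) ->
  K = jacobian tau 0 *m H *m (jacobian tau 0)^T.
Proof.
move=> Hs Ks [_ _ gH] [_ _ hK] dt t0 gh.
apply: quad_form_ext => // [|v]; first by rewrite !trmx_mul trmxK Hs mulmxA.
have -> : v *m (jacobian tau 0 *m H *m (jacobian tau 0)^T) *m v^T =
    'D_v tau 0 *m H *m ('D_v tau 0)^T.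
  by rewrite deriveEjacobian // trmx_mul !mulmxA.
have [c [dc c0 Dc cc]] : exists c : R -> 'rV[R]_d,
    [/\ differentiable c (0 : R), c 0 = 0, 'D_1 c 0 = v & c t @[t --> (0 : R)] --> (0 : 'rV[R]_d)].
  have dc : differentiable (fun t : R => t *: v) (0 : R) by [].
  exists (fun t => t *: v); split => //; first by rewrite scale0r.
    by rewrite deriveE // diff_val scale1r.
  have : t *: v @[t --> (0 : R)] --> (0 : R) *: v := differentiable_continuous dc.
  by rewrite scale0r.
have dtc : differentiable (tau \o c) 0 by apply: differentiable_comp; rewrite ?c0.
have Dtc : 'D_1 (tau \o c) 0 = 'D_v tau 0.
  by rewrite deriveE // diff_comp ?c0 //= -(deriveE _ dc) Dc deriveE.
have := hK c dc c0; rewrite Dc => limK.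
have := gH (tau \o c) dtc; rewrite /= c0 t0 Dtc => /(_ erefl) limH.
have E : (v *m K *m v^T) 0 0 / 2 =
    ('D_v tau 0 *m H *m ('D_v tau 0)^T) 0 0 / 2.
  rewrite -(cvg_lim (@Rhausdorff R) limK); apply: (cvg_lim (@Rhausdorff R)).
  apply: cvg_trans limH; apply: near_eq_cvg; apply: nbhs_dnbhs.
  have g0 : g 0 = h 0 by have := nbhs_singleton gh; rewrite t0.
  have ghc : \forall t \near (0 : R), g (tau (c t)) = h (c t) := cc _ gh.
  by move: ghc; apply: filterS => t; rewrite /= g0 => ->.
by apply: (mulIf _ E); rewrite invr_eq0 pnatr_eq0.
Qed.

End Charts.

(** * The Hessian at a cyclic polygon *)

Section Algebra.
Variable F : realFieldType.
Implicit Types (r t X Y a b z s e l : F).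

(* Inverse stereographic projection from the point [(r, 0)] of the circle of
   radius [r]; [multiplier t t'] is half the cotangent of half the angle under
   which the centre sees the edge from [t] to [t']. *)
Definition circle_x r t := r * (t ^+ 2 - 1) / (t ^+ 2 + 1).
Definition circle_y r t := 2 * r * t / (t ^+ 2 + 1).
Definition multiplier t t' := (1 + t * t') / (2 * (t - t')).

Lemma sqr1_neq0 t : t ^+ 2 + 1 != 0.
Proof. by rewrite gt_eqF // ltr_wpDl ?sqr_ge0. Qed.

Lemma circleE r t : circle_x r t ^+ 2 + circle_y r t ^+ 2 = r ^+ 2.
Proof. by rewrite /circle_x /circle_y; field; rewrite sqr1_neq0. Qed.

(** With [multiplier_y]: the multiplier times the edge vector is the quarter turn of the midpoint of
    the edge. These are the first-order conditions for the Lagrange function, edge by edge. *)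
Lemma multiplier_x r t t' : t != t' ->
  multiplier t t' * (circle_x r t' - circle_x r t) =
  - ((circle_y r t + circle_y r t') / 2).
Proof.
rewrite -subr_eq0 => tt; rewrite /multiplier /circle_x /circle_y; field.
by rewrite tt !sqr1_neq0.
Qed.

Lemma multiplier_y r t t' : t != t' ->
  multiplier t t' * (circle_y r t' - circle_y r t) =
  (circle_x r t + circle_x r t') / 2.
Proof.
rewrite -subr_eq0 => tt; rewrite /multiplier /circle_x /circle_y; field.
by rewrite tt !sqr1_neq0.
Qed.

(** Scheme for identities modulo hypotheses: [w] is an explicit combination of the hypotheses, the
    first premise is a formal identity, and the second follows by substituting them. *)
Lemma eq_of_sub_eq0 (x y w : F) : x - y = w -> w = 0 -> x = y.
Proof. by move=> <- /eqP; rewrite subr_eq0 => /eqP. Qed.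

(* Contribution of an edge to the vector area after a displacement (a, b, z) of
   its vertices and (e1, e2, e3) of the normal: up to a term which telescopes, a
   sum of products of quantities which vanish with the displacement. *)
Lemma area_expansion l X Y X' Y' a b z a' b' z' e1 e2 e3 :
  l * (X' - X) = - ((Y + Y') / 2) -> l * (Y' - Y) = (X + X') / 2 ->
  (X' - X + (a' - a)) ^+ 2 + (Y' - Y + (b' - b)) ^+ 2 + (z' - z) ^+ 2 =
    (X' - X) ^+ 2 + (Y' - Y) ^+ 2 ->
  e1 ^+ 2 + e2 ^+ 2 + (1 + e3) ^+ 2 = 1 ->
  2^-1 * (((Y + b) * z' - z * (Y' + b')) * e1 + (z * (X' + a') - (X + a) * z') * e2
    + ((X + a) * (Y' + b') - (Y + b) * (X' + a')) * (1 + e3)) =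
  2^-1 * (X * Y' - Y * X')
  + ((- (l / 2) * (1 + e3) * (a' - a)) * (a' - a)
   + (- (l / 2) * (1 + e3) * (b' - b)) * (b' - b)
   + (- (l / 2) * (1 + e3) * (z' - z)) * (z' - z)
   + (2^-1 * (1 + e3) * a) * b' + (- 2^-1 * (1 + e3) * b) * a'
   + (- ((X * Y' - Y * X') / 4) * e1) * e1 + (- ((X * Y' - Y * X') / 4) * e2) * e2
   + (- ((X * Y' - Y * X') / 4) * e3) * e3
   + (2^-1 * e1) * ((Y + b) * z' - z * (Y' + b'))
   + (2^-1 * e2) * (z * (X' + a') - (X + a) * z'))
  - (1 + e3) * ((X' * b' - Y' * a') / 2 - (X * b - Y * a) / 2).
Proof.
move=> hx hy hc he.
apply: (@eq_of_sub_eq0 _ _ ((1 + e3) * (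
   - (l * (X' - X) + (Y + Y') / 2) * (a' - a)
   - (l * (Y' - Y) - (X + X') / 2) * (b' - b)
   + l / 2 * ((X' - X + (a' - a)) ^+ 2 + (Y' - Y + (b' - b)) ^+ 2 + (z' - z) ^+ 2
       - ((X' - X) ^+ 2 + (Y' - Y) ^+ 2)))
   + (X * Y' - Y * X') / 4 * (e1 ^+ 2 + e2 ^+ 2 + (1 + e3) ^+ 2 - 1))).
  by field.
by rewrite hx hy hc he; ring.
Qed.

(* [r * s] is the vertical displacement after rotating the normal back; moving
   the vertices with speed [s] along the circle turns the vertical part of the
   quadratic form into a planar one, up to the telescoping term [G]. *)
Lemma hessian_absorb l r X Y X' Y' a b z s a' b' z' s' e1 e2 :
  l * (X' - X) = - ((Y + Y') / 2) -> l * (Y' - Y) = (X + X') / 2 ->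
  X ^+ 2 + Y ^+ 2 = r ^+ 2 -> X' ^+ 2 + Y' ^+ 2 = r ^+ 2 -> r != 0 ->
  (X' - X) * (a' - a) + (Y' - Y) * (b' - b) = 0 ->
  r * s = z + X * e1 + Y * e2 -> r * s' = z' + X' * e1 + Y' * e2 ->
  let G X Y a b z s := s * (a * X + b * Y) + e1 * z * Y - e2 * z * X
    + e1 ^+ 2 * X * Y / 2 + e1 * e2 * (Y ^+ 2 - X ^+ 2) / 2 - e2 ^+ 2 * X * Y / 2 in
  a * b' - b * a' - l * ((a' - a) ^+ 2 + (b' - b) ^+ 2 + (z' - z) ^+ 2)
    - (X * Y' - Y * X') / 2 * (e1 ^+ 2 + e2 ^+ 2)
    + e1 * (Y * z' - z * Y') + e2 * (z * X' - X * z') =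
  (a - s * Y) * (b' + s' * X') - (b + s * X) * (a' - s' * Y')
    - l * ((a' - s' * Y' - (a - s * Y)) ^+ 2 + (b' + s' * X' - (b + s * X)) ^+ 2)
    - (G X' Y' a' b' z' s' - G X Y a b z s).
Proof.
move=> hx hy hr hr' r0 hd hs hs' G.
(* If the edge vanished, the multiplier equations would put its endpoints at the centre, against
   [r != 0]. *)
have D0 : (X' - X) ^+ 2 + (Y' - Y) ^+ 2 != 0.
  apply/eqP => /eqP; rewrite paddr_eq0 ?sqr_ge0 // !sqrf_eq0 => /andP[/eqP x0 /eqP y0].
  move: hx hy; rewrite x0 y0 !mulr0 => hx hy.
  have Y0 : Y = 0 by lra.
  have X0 : X = 0 by lra.
  by move: hr; rewrite X0 Y0 expr0n addr0 => /esym/eqP; rewrite sqrf_eq0 (negPf r0).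
(* By the linearised length constraint the relative displacement is orthogonal to the edge, so it is
   [t] times the quarter turn of the edge. *)
pose t := ((b' - b) * (X' - X) - (a' - a) * (Y' - Y)) / ((X' - X) ^+ 2 + (Y' - Y) ^+ 2).
have ha : a' = a - t * (Y' - Y).
  apply: (mulIf D0); apply: (@eq_of_sub_eq0 _ _ ((X' - X) *
     ((X' - X) * (a' - a) + (Y' - Y) * (b' - b)))); last by rewrite hd mulr0.
  by rewrite /t; field.
have hb : b' = b + t * (X' - X).
  apply: (mulIf D0); apply: (@eq_of_sub_eq0 _ _ ((Y' - Y) *
     ((X' - X) * (a' - a) + (Y' - Y) * (b' - b)))); last by rewrite hd mulr0.
  by rewrite /t; field.
have hz : z = r * s - X * e1 - Y * e2 by rewrite hs; ring.
have hz' : z' = r * s' - X' * e1 - Y' * e2 by rewrite hs'; ring.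
clearbody t; subst a' b' z z'.
pose K := 2 * (r * s' - X' * e1 - Y' * e2 - (r * s - X * e1 - Y * e2))
   + (X' - X) * e1 + (Y' - Y) * e2.
apply/esym; apply: (@eq_of_sub_eq0 _ _ (
  (- 2 * t * (s' * X' - s * X) - e1 * K - s * s' * (X' - X))
     * (l * (X' - X) + (Y + Y') / 2)
  + (- 2 * t * (s' * Y' - s * Y) - e2 * K - s * s' * (Y' - Y))
     * (l * (Y' - Y) - (X + X') / 2)
  + l * (- s' ^+ 2 * (X' ^+ 2 + Y' ^+ 2 - r ^+ 2) - s ^+ 2 * (X ^+ 2 + Y ^+ 2 - r ^+ 2)
    + s * s' * (X ^+ 2 + Y ^+ 2 - r ^+ 2 + (X' ^+ 2 + Y' ^+ 2 - r ^+ 2))))).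
  by rewrite /K /G; field.
by rewrite hx hy hr hr'; ring.
Qed.

(** The squares on the right are those of the differences of the real and imaginary parts of (A + i
    B) (1 + i t). *)
Lemma hessian_complete_square t t' A B A' B' : t != t' ->
  A * B' - B * A' - multiplier t t' * ((A' - A) ^+ 2 + (B' - B) ^+ 2) =
  - (2^-1 * (((A' - B' * t' - (A - B * t)) ^+ 2
            + (A' * t' + B' - (A * t + B)) ^+ 2) / (t - t')))
  - (t' * (A' ^+ 2 + B' ^+ 2) / 2 - t * (A ^+ 2 + B ^+ 2) / 2).
Proof. by rewrite -subr_eq0 => tt; rewrite /multiplier; field. Qed.

End Algebra.

(** * First and second order data, computed along expressions *)

Section FirstOrder.
Variables (R : realType) (d : nat).
Local Notation V := 'rV[R]_d.
Implicit Types (f g h : V -> R) (D E : V -> R).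

(** Value and differential at 0 are explicit data, so that they can be computed by following the
    syntax of [f]. *)
Definition jet1 f a D :=
  [/\ jet2 f, f 0 = a & forall v, (v *m grad f) 0 0 = D v].

Lemma jet1_cst a : jet1 (fun=> a) a (fun=> 0).
Proof.
split => //; first exact: jet2_cst.
by move=> v; rewrite grad_cst mulmx0 mxE.
Qed.

Lemma jet2_diff f : jet2 f -> differentiable f (0 : V).
Proof. by case=> /nbhs_singleton. Qed.

Lemma jet1D f g a b D E : jet1 f a D -> jet1 g b E ->
  jet1 (fun x => f x + g x) (a + b) (fun v => D v + E v).
Proof.
move=> [jf f0 Df] [jg g0 Dg]; split; [exact: jet2D|by rewrite f0 g0|move=> v].
rewrite (gradD (jet2_diff jf) (jet2_diff jg)) mulmxDr mxE.
by rewrite Df Dg.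
Qed.

Lemma jet1M f g a b D E : jet1 f a D -> jet1 g b E ->
  jet1 (fun x => f x * g x) (a * b) (fun v => a * E v + b * D v).
Proof.
move=> [jf f0 Df] [jg g0 Dg]; split; [exact: jet2M|by rewrite f0 g0|move=> v].
rewrite (gradM (jet2_diff jf) (jet2_diff jg)) mulmxDr -!scalemxAr f0 g0.
by rewrite mxE [X in X + _]mxE [X in _ + X]mxE Df Dg.
Qed.

Lemma jet1N f a D : jet1 f a D -> jet1 (fun x => - f x) (- a) (fun v => - D v).
Proof.
move=> jf; have := jet1M (jet1_cst (-1)) jf.
rewrite (_ : (fun x => -1 * f x) = fun x => - f x); last first.
  by apply/funext => x; rewrite mulN1r.
by case=> j f0 Df; split => [//||v]; [rewrite f0|rewrite Df]; ring.
Qed.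

Lemma jet1_ext f a D b E : jet1 f a D -> a = b -> D =1 E -> jet1 f b E.
Proof. by move=> [jf f0 Df] <- DE; split => // v; rewrite Df DE. Qed.

Lemma jet1_near_cst f a b D : jet1 f a D -> {near (0 : V), f =1 cst b} ->
  forall v, D v = 0.
Proof.
move=> [_ _ Df] fb v; rewrite -Df (near_eq_grad fb) (grad_cst _ b) mulmx0 mxE //.
Qed.

(** [Q] is the Hessian form itself, twice the second-order term of [g]; hence the factor 2 in
    [qformM]. *)
Definition qform g (Q : V -> R) :=
  exists H : 'M[R]_d, [/\ qjet g H, H^T = H & forall v, (v *m H *m v^T) 0 0 = Q v].

Lemma qformM f g D E : jet1 f 0 D -> jet1 g 0 E ->
  qform (fun x => f x * g x) (fun v => 2 * (D v * E v)).
Proof.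
move=> [jf f0 Df] [jg g0 Dg].
exists (grad f *m (grad g)^T + grad g *m (grad f)^T); split; first exact: qjetM.
  by rewrite linearD /= !trmx_mul !trmxK addrC.
move=> v; rewrite mulmxDr mulmxDl !mulmxA -!(mulmxA (v *m _)) -!trmx_mul.
by rewrite mxE !outer11 Df Dg mulrDl !mul1r [X in _ + X]mulrC.
Qed.

Lemma qformD f g D E : qform f D -> qform g E ->
  qform (fun x => f x + g x) (fun v => D v + E v).
Proof.
move=> [H [qf Hs HD]] [K [qg Ks KE]]; exists (H + K).
split; [exact: qjetD|by rewrite linearD /= Hs Ks|move=> v].
by rewrite mulmxDr mulmxDl mxE HD KE.
Qed.

Lemma qform_cst a : qform (fun=> a) (fun=> 0).
Proof.
exists 0; split; [exact: qjet_cst|exact: trmx0|move=> v].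
by rewrite mulmx0 mul0mx mxE.
Qed.

Lemma qform_sum (I : finType) (f : I -> V -> R) (D : I -> V -> R) :
  (forall i, qform (f i) (D i)) ->
  qform (fun x => \sum_i f i x) (fun v => \sum_i D i v).
Proof.
move=> fD.
rewrite (_ : (fun x => _) = \sum_i f i); last first.
  by apply/funext => x; rewrite fct_sumE.
rewrite (_ : (fun v => _) = \sum_i D i); last first.
  by apply/funext => x; rewrite fct_sumE.
elim/big_ind2 : _ => //; first exact: qform_cst.
by move=> ? ? ? ?; exact: qformD.
Qed.

Lemma near_eq_qform f g D E : {near (0 : V), g =1 f} -> D =1 E -> qform f D -> qform g E.
Proof.
move=> fg DE [H [qf Hs HD]]; exists H; split => //; first exact: near_eq_qjet qf.
by move=> v; rewrite HD DE.
Qed.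

End FirstOrder.

Lemma vector_areaE (R : realType) (n : nat) (x : config R n) :
  vector_area x = \sum_i 2^-1 *
   ((x.1 i 1 * x.1 (ordS i) 2 - x.1 i 2 * x.1 (ordS i) 1) * x.2 0 0
    + (x.1 i 2 * x.1 (ordS i) 0 - x.1 i 0 * x.1 (ordS i) 2) * x.2 0 1
    + (x.1 i 0 * x.1 (ordS i) 1 - x.1 i 1 * x.1 (ordS i) 0) * x.2 0 2).
Proof.
rewrite -mulr_sumr /vector_area dotE !summxE !mulr_suml -!big_split /=.
have rE j k : row j x.1 0 k = x.1 j k by rewrite mxE.
by congr (_ * _); apply: eq_bigr => i _; rewrite !crossE !rE.
Qed.

Lemma sqr_edge (R : realType) (n : nat) (L : 'I_n -> R) (P : 'M[R]_(n, 3)) i :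
  polygon_with_sides L P ->
  (P (ordS i) 0 - P i 0) ^+ 2 + (P (ordS i) 1 - P i 1) ^+ 2
    + (P (ordS i) 2 - P i 2) ^+ 2 = L i ^+ 2.
Proof. by move=> /(_ i) <-; rewrite enorm_sqr dotE -!expr2 !mxE. Qed.

(** * Second variation of the vector area *)

Section AreaExpansion.
Variables (R : realType) (n d : nat) (r : R) (t : 'I_n -> R).
Hypothesis r0 : r != 0.
Hypothesis t_neq : forall i, t i != t (ordS i).
Variables (X Y l : 'I_n -> R).
Hypothesis XE : forall i, X i = circle_x r (t i).
Hypothesis YE : forall i, Y i = circle_y r (t i).
Hypothesis lE : forall i, l i = multiplier (t i) (t (ordS i)).
Variables (a b z : 'I_n -> 'rV[R]_d -> R) (e1 e2 e3 : 'rV[R]_d -> R).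
Variables (Da Db Dz : 'I_n -> 'rV[R]_d -> R) (De1 De2 De3 : 'rV[R]_d -> R).
Hypothesis ja : forall i, jet1 (a i) 0 (Da i).
Hypothesis jb : forall i, jet1 (b i) 0 (Db i).
Hypothesis jz : forall i, jet1 (z i) 0 (Dz i).
Hypothesis je1 : jet1 e1 0 De1.
Hypothesis je2 : jet1 e2 0 De2.
Hypothesis je3 : jet1 e3 0 De3.
Hypothesis edgeE : \forall u \near (0 : 'rV[R]_d), forall i,
   (X (ordS i) - X i + (a (ordS i) u - a i u)) ^+ 2
   + (Y (ordS i) - Y i + (b (ordS i) u - b i u)) ^+ 2
   + (z (ordS i) u - z i u) ^+ 2 = (X (ordS i) - X i) ^+ 2 + (Y (ordS i) - Y i) ^+ 2.
Hypothesis normE : \forall u \near (0 : 'rV[R]_d),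
    e1 u ^+ 2 + e2 u ^+ 2 + (1 + e3 u) ^+ 2 = 1.

Ltac jet1_tac := repeat lazymatch goal with
  | |- jet1 (fun u => @?f u + @?g u) _ _ => apply: jet1D
  | |- jet1 (fun u => @?f u * @?g u) _ _ => apply: jet1M
  | |- jet1 (fun u => - @?f u) _ _ => apply: jet1N
  | |- jet1 (fun u => ?c) _ _ => exact: jet1_cst
  | |- jet1 (fun u => a _ u) _ _ => exact: ja
  | |- jet1 (fun u => b _ u) _ _ => exact: jb
  | |- jet1 (fun u => z _ u) _ _ => exact: jz
  | |- jet1 (a _) _ _ => exact: ja
  | |- jet1 (b _) _ _ => exact: jb
  | |- jet1 (z _) _ _ => exact: jz
  | |- _ => first [exact: je1 | exact: je2 | exact: je3]
  end.

(** Differentiating |xi|^2 = 1 shows that the normal moves horizontally to first order. *)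
Lemma normal_derivative v : De3 v = 0.
Proof.
have j : jet1 (fun u => e1 u * e1 u + e2 u * e2 u + (1 + e3 u) * (1 + e3 u)) 1
    (fun v => 2 * De3 v).
  apply: jet1_ext; first by jet1_tac.
    by ring.
  by move=> w /=; ring.
have := jet1_near_cst j normE v; lra.
Qed.

(** The linearised length constraint; the polygon is planar, so vertical displacements enter the
    lengths only to second order. *)
Lemma edge_derivative i v : (X (ordS i) - X i) * (Da (ordS i) v - Da i v)
   + (Y (ordS i) - Y i) * (Db (ordS i) v - Db i v) = 0.
Proof.
pose p := X (ordS i) - X i; pose q := Y (ordS i) - Y i.
pose f u := (p + (a (ordS i) u - a i u)) * (p + (a (ordS i) u - a i u))
    + (q + (b (ordS i) u - b i u)) * (q + (b (ordS i) u - b i u))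
    + (z (ordS i) u - z i u) * (z (ordS i) u - z i u).
have j : jet1 f (p ^+ 2 + q ^+ 2)
    (fun v => 2 * (p * (Da (ordS i) v - Da i v) + q * (Db (ordS i) v - Db i v))).
  rewrite /f; apply: jet1_ext; first by jet1_tac.
    by ring.
  by move=> w /=; ring.
have c : {near (0 : 'rV[R]_d), f =1 cst (p ^+ 2 + q ^+ 2)}.
  by move: edgeE; apply: filterS => u /(_ i).
by have /eqP := jet1_near_cst j c v; rewrite mulf_eq0 pnatr_eq0 => /eqP.
Qed.

Let cr i := X i * Y (ordS i) - Y i * X (ordS i).

(** The bracket of [area_expansion], with every summand written as a product of two functions
    vanishing at 0, the shape that [qformM] accepts. *)
Definition area_defect i u :=
  (- (l i / 2) * (1 + e3 u) * (a (ordS i) u - a i u)) * (a (ordS i) u - a i u)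
   + (- (l i / 2) * (1 + e3 u) * (b (ordS i) u - b i u)) * (b (ordS i) u - b i u)
   + (- (l i / 2) * (1 + e3 u) * (z (ordS i) u - z i u)) * (z (ordS i) u - z i u)
   + (2^-1 * (1 + e3 u) * a i u) * b (ordS i) u + (- 2^-1 * (1 + e3 u) * b i u) * a (ordS i) u
   + (- (cr i / 4) * e1 u) * e1 u + (- (cr i / 4) * e2 u) * e2 u
   + (- (cr i / 4) * e3 u) * e3 u
   + (2^-1 * e1 u) * ((Y i + b i u) * z (ordS i) u - z i u * (Y (ordS i) + b (ordS i) u))
   + (2^-1 * e2 u) * (z i u * (X (ordS i) + a (ordS i) u) - (X i + a i u) * z (ordS i) u).

Lemma sum_area_defect : \forall u \near (0 : 'rV[R]_d),
  \sum_i 2^-1 *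
    (((Y i + b i u) * z (ordS i) u - z i u * (Y (ordS i) + b (ordS i) u)) * e1 u
    + (z i u * (X (ordS i) + a (ordS i) u) - (X i + a i u) * z (ordS i) u) * e2 u
    + ((X i + a i u) * (Y (ordS i) + b (ordS i) u)
       - (Y i + b i u) * (X (ordS i) + a (ordS i) u)) * (1 + e3 u)) =
  \sum_i 2^-1 * cr i + \sum_i area_defect i u.
Proof.
near=> u.
have ed : forall i, (X (ordS i) - X i + (a (ordS i) u - a i u)) ^+ 2
   + (Y (ordS i) - Y i + (b (ordS i) u - b i u)) ^+ 2
   + (z (ordS i) u - z i u) ^+ 2 = (X (ordS i) - X i) ^+ 2 + (Y (ordS i) - Y i) ^+ 2.
  by near: u.
have no : e1 u ^+ 2 + e2 u ^+ 2 + (1 + e3 u) ^+ 2 = 1 by near: u.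
pose G i := (X i * b i u - Y i * a i u) / 2.
rewrite (eq_bigr (fun i => 2^-1 * cr i + area_defect i u
    - (1 + e3 u) * (G (ordS i) - G i))).
  by rewrite sumrB big_split /= -[X in _ - X]mulr_sumr sum_ordS_sub mulr0 subr0.
move=> i _; apply: area_expansion => //.
  by rewrite lE !XE !YE multiplier_x.
by rewrite lE !XE !YE multiplier_y.
Unshelve. all: by end_near. Qed.

Let Q i (v : 'rV[R]_d) := Da i v * Db (ordS i) v - Db i v * Da (ordS i) v
   - l i * ((Da (ordS i) v - Da i v) ^+ 2 + (Db (ordS i) v - Db i v) ^+ 2
       + (Dz (ordS i) v - Dz i v) ^+ 2)
   - cr i / 2 * (De1 v ^+ 2 + De2 v ^+ 2)
   + De1 v * (Y i * Dz (ordS i) v - Dz i v * Y (ordS i))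
   + De2 v * (Dz i v * X (ordS i) - X i * Dz (ordS i) v).

Lemma qform_area_defect i : qform (area_defect i) (Q i).
Proof.
(* The form is left open, read off the syntax of [area_defect], and only then compared with [Q]. *)
apply: (@near_eq_qform _ _ (area_defect i)); last first.
- rewrite /area_defect; repeat lazymatch goal with
    | |- qform (fun u => @?f u + @?g u) _ => apply: qformD end; apply: qformM;
    (apply: jet1_ext; [by jet1_tac | by ring | by move=> w /=; reflexivity]).
- by move=> v /=; rewrite /Q !normal_derivative; field.
- by near=> u.
Unshelve. all: by end_near. Qed.

Lemma qform_vector_area_defect : exists (U : bool -> 'I_n -> 'cV[R]_d),
  forall v : 'rV[R]_d, \sum_i Q i v = - (2^-1 * \sum_(c : bool) \sum_i
      ((v *m U c (ordS i)) 0 0 - (v *m U c i) 0 0) ^+ 2 / (t i - t (ordS i))).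
Proof.
(* [s i] is the vertical displacement, with the normal rotated back, divided by [r]. Then [A i] and
   [B i] are the components of W_i, and the functions in [j1] and [j2] are the real and imaginary
   parts of U_i. *)
pose s i u := (z i u + X i * e1 u + Y i * e2 u) * r^-1.
pose Ds i v := (Dz i v + X i * De1 v + Y i * De2 v) * r^-1.
pose A i u := a i u - s i u * Y i.
pose B i u := b i u + s i u * X i.
pose DA i v := Da i v - Ds i v * Y i.
pose DB i v := Db i v + Ds i v * X i.
have j1 i : jet1 (fun u => A i u - B i u * t i) 0 (fun v => DA i v - DB i v * t i).
  rewrite /A /B /s /DA /DB /Ds; apply: jet1_ext; first by jet1_tac.
    by ring.
  by move=> v /=; ring.
have j2 i : jet1 (fun u => A i u * t i + B i u) 0 (fun v => DA i v * t i + DB i v).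
  rewrite /A /B /s /DA /DB /Ds; apply: jet1_ext; first by jet1_tac.
    by ring.
  by move=> v /=; ring.
exists (fun c i => if c then grad (fun u => A i u - B i u * t i)
   else grad (fun u => A i u * t i + B i u)) => v.
have UE (c : bool) i : (v *m (if c then grad (fun u => A i u - B i u * t i)
   else grad (fun u => A i u * t i + B i u))) 0 0 =
   if c then DA i v - DB i v * t i else DA i v * t i + DB i v.
  by case: c; [case: (j1 i) => _ _ ->|case: (j2 i) => _ _ ->].
under [in RHS]eq_bigr do under eq_bigr do rewrite !UE.
rewrite big_bool /= -big_split /= mulr_sumr -sumrN.
(* [G1] and [G2] are the telescoping terms of [hessian_absorb] and [hessian_complete_square]. *)
pose G1 i := Ds i v * (Da i v * X i + Db i v * Y i) + De1 v * Dz i v * Y i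
    - De2 v * Dz i v * X i + De1 v ^+ 2 * X i * Y i / 2
    + De1 v * De2 v * (Y i ^+ 2 - X i ^+ 2) / 2 - De2 v ^+ 2 * X i * Y i / 2.
pose G2 i := t i * (DA i v ^+ 2 + DB i v ^+ 2) / 2.
rewrite [LHS](eq_bigr (fun i => - (2^-1 *
   (((DA (ordS i) v - DB (ordS i) v * t (ordS i) - (DA i v - DB i v * t i)) ^+ 2
    / (t i - t (ordS i))) +
    ((DA (ordS i) v * t (ordS i) + DB (ordS i) v - (DA i v * t i + DB i v)) ^+ 2
    / (t i - t (ordS i))))) - (G2 (ordS i) - G2 i) - (G1 (ordS i) - G1 i))).
  by rewrite 2!sumrB !sum_ordS_sub !subr0.
move=> i _; rewrite -mulrDl -hessian_complete_square // -lE.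
have rs j : r * Ds j v = Dz j v + X j * De1 v + Y j * De2 v.
  by rewrite /Ds mulrC divfK.
have hx : l i * (X (ordS i) - X i) = - ((Y i + Y (ordS i)) / 2).
  by rewrite lE !XE !YE multiplier_x.
have hy : l i * (Y (ordS i) - Y i) = (X i + X (ordS i)) / 2.
  by rewrite lE !XE !YE multiplier_y.
have hr j : X j ^+ 2 + Y j ^+ 2 = r ^+ 2 by rewrite XE YE circleE.
have := hessian_absorb hx hy (hr i) (hr (ordS i)) r0 (edge_derivative i v)
   (rs i) (rs (ordS i)).
by rewrite /Q => ->.
Qed.

End AreaExpansion.

Section Canonical.
Variables (R : realType) (n d : nat) (L : 'I_n -> R) (r : R) (t : 'I_n -> R).
Variable psi : 'rV[R]_d -> config R n.

Lemma canonical_hessian :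
  r != 0 -> (forall i, t i != t (ordS i)) ->
  (forall i k, jet2 (fun u => (psi u).1 i k)) ->
  (forall k, jet2 (fun u => (psi u).2 0 k)) ->
  (\forall u \near (0 : 'rV[R]_d), decorated L (psi u)) ->
  (forall i, (psi 0).1 i 0 = circle_x r (t i)) ->
  (forall i, (psi 0).1 i 1 = circle_y r (t i)) ->
  (forall i, (psi 0).1 i 2 = 0) ->
  (psi 0).2 = delta_mx 0 2 ->
  exists (H : 'M[R]_d) (U : bool -> 'I_n -> 'cV[R]_d),
  [/\ qjet (fun u => vector_area (psi u)) H, H^T = H & forall v : 'rV[R]_d,
    (v *m H *m v^T) 0 0 = - (2^-1 * \sum_(c : bool) \sum_i
      ((v *m U c (ordS i)) 0 0 - (v *m U c i) 0 0) ^+ 2 / (t i - t (ordS i)))].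
Proof.
move=> r0 t_neq jet_vertex jet_normal psi_dec psi0x psi0y psi0z psi0n.
pose X i := circle_x r (t i); pose Y i := circle_y r (t i).
(* Displacements from the cyclic polygon and from the vertical normal, normalised to vanish at 0.
   Lengths near 0 and at 0 both equal [L], which yields the constraint [edgeE]. *)
pose a i u := (psi u).1 i 0 - X i.
pose b i u := (psi u).1 i 1 - Y i.
pose z i u := (psi u).1 i 2.
pose e1 u := (psi u).2 0 0.
pose e2 u := (psi u).2 0 1.
pose e3 u := (psi u).2 0 2 - 1.
have jetE0 (f : 'rV[R]_d -> R) : jet2 f -> f 0 = 0 -> jet1 f 0 (fun v => (v *m grad f) 0 0).
  by [].
have jetE (f : 'rV[R]_d -> R) c : jet2 f -> f 0 = c ->
    jet1 (fun u => f u - c) 0 (fun v => (v *m grad (fun u => f u - c)) 0 0).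
  move=> jf f0; apply: jetE0; last by rewrite f0 subrr.
  by apply: jet2D => //; exact: jet2_cst.
have ja i := jetE _ (X i) (jet_vertex i 0) (psi0x i).
have jb i := jetE _ (Y i) (jet_vertex i 1) (psi0y i).
have jz i := jetE0 _ (jet_vertex i 2) (psi0z i).
have nE k c : (delta_mx 0 2 : 'rV[R]_3) 0 k = c -> (psi 0).2 0 k = c by rewrite psi0n.
have je1 : jet1 e1 0 (fun v => (v *m grad e1) 0 0).
  by apply: jetE0; [exact: jet_normal|apply: (nE 0); rewrite mxE].
have je2 : jet1 e2 0 (fun v => (v *m grad e2) 0 0).
  by apply: jetE0; [exact: jet_normal|apply: (nE 1); rewrite mxE].
have je3 : jet1 e3 0 (fun v => (v *m grad e3) 0 0).
  by apply: jetE; [exact: jet_normal|apply: (nE 2); rewrite mxE].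
have edgeE : \forall u \near (0 : 'rV[R]_d), forall i,
   (X (ordS i) - X i + (a (ordS i) u - a i u)) ^+ 2
   + (Y (ordS i) - Y i + (b (ordS i) u - b i u)) ^+ 2
   + (z (ordS i) u - z i u) ^+ 2 = (X (ordS i) - X i) ^+ 2 + (Y (ordS i) - Y i) ^+ 2.
  have [/= p0 _] := nbhs_singleton psi_dec.
  move: psi_dec; apply: filterS => u [/= pu _] i.
  have := sqr_edge i p0; rewrite -(sqr_edge i pu) !psi0x !psi0y !psi0z -/X -/Y.
  rewrite subrr expr0n addr0 => ->; rewrite /a /b /z.
  by congr (_ ^+ 2 + _ ^+ 2 + _); ring.
have normE : \forall u \near (0 : 'rV[R]_d),
    e1 u ^+ 2 + e2 u ^+ 2 + (1 + e3 u) ^+ 2 = 1.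
  move: psi_dec; apply: filterS => u [_ /= x1].
  have := enorm_sqr (psi u).2; rewrite x1 dotE expr1n -!expr2 => h.
  by rewrite [RHS]h /e3 addrCA subrr addr0.
pose l i := multiplier (t i) (t (ordS i)).
have [U HU] := qform_vector_area_defect r0 t_neq (fun i => erefl (X i))
   (fun i => erefl (Y i)) (fun i => erefl (l i)) ja jb jz je1 je2 edgeE.
have TQ := qform_area_defect X Y l ja jb jz je1 je2 je3 normE.
have areaE := sum_area_defect t_neq (fun i => erefl (X i))
   (fun i => erefl (Y i)) (fun i => erefl (l i)) edgeE normE.
have [H [qH Hs HQ]] := qformD (qform_cst _ (\sum_i 2^-1 * (X i * Y (ordS i) - Y i * X (ordS i))))
  (qform_sum TQ).
exists H, U; split => //; last by move=> v; rewrite HQ add0r HU.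
apply: near_eq_qjet qH; move: areaE; apply: filterS => u /= <-.
rewrite vector_areaE; apply: eq_bigr => i _; congr (_ * _).
have aK j : X j + a j u = (psi u).1 j 0 by rewrite /a addrC subrK.
have bK j : Y j + b j u = (psi u).1 j 1 by rewrite /b addrC subrK.
have eK : 1 + e3 u = (psi u).2 0 2 by rewrite /e3 addrC subrK.
by rewrite !aK !bK eK.
Qed.

End Canonical.

(** * Winding number and canonical position *)

Section Winding.
Variables (R : realType) (n : nat).

(** The point with stereographic coordinate t has polar angle pi - 2 atan t, so increasing t means
    moving clockwise. *)
Lemma circle_x_atan (r t : R) : circle_x r t = - (r * cos (atan t *+ 2)).
Proof.
rewrite cos_2atan /circle_x [1 + t ^+ 2]addrC; have := sqr1_neq0 t => t1.
by field.
Qed.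

Lemma circle_y_atan (r t : R) : circle_y r t = r * sin (atan t *+ 2).
Proof.
rewrite sin_2atan /circle_y [1 + t ^+ 2]addrC; have := sqr1_neq0 t => t1.
by field.
Qed.

(* By the inscribed angle theorem [atan t - atan t'] is the angle under which the
   base point t = oo of the circle sees the edge, and twice it is the angle at
   the centre modulo 2 pi; a full turn is missed exactly when the edge separates
   the base point from the centre. *)
Lemma acos_circle (r t t' : R) : 0 < r -> t != t' ->
  let S := circle_x r t * circle_y r t' - circle_y r t * circle_x r t' in
  let C := circle_x r t * circle_x r t' + circle_y r t * circle_y r t' in
  S != 0 ->
  Num.sg S * acos (C / (r * r)) =
  (atan t - atan t') *+ 2 + 2 * pi * ((0 < S)%R%:R - (t' < t)%R%:R).
Proof.
move=> r0 tt S C; have rr : 0 < r * r by rewrite mulr_gt0.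
have -> : S = r * r * sin ((atan t - atan t') *+ 2).
  by rewrite mulrnBl sinB /S !circle_x_atan !circle_y_atan; ring.
have -> : C / (r * r) = cos ((atan t - atan t') *+ 2).
  rewrite mulrnBl cosB /C !circle_x_atan !circle_y_atan; field.
  by rewrite gt_eqF.
rewrite mulf_eq0 negb_or => /andP[_ s0].
rewrite sgrM gtr0_sg // mul1r pmulr_rgt0 // acos_cos_lift //.
  have -> // : (0 < atan t - atan t') = (t' < t).
  rewrite subr_gt0; have [|lt|lt] := ltgtP t' t.
  - by move=> h; rewrite lt_atan.
  - by rewrite lt_gtF // lt_atan.
  - by rewrite lt eqxx in tt.
have := atan_gtNpi2 t; have := atan_ltpi2 t.
have := atan_gtNpi2 t'; have := atan_ltpi2 t'.
by move=> h1 h2 h3 h4; apply/andP; split; lra.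
Qed.

(** Summing [acos_circle] over the edges, the differences of [atan] telescope and only the two
    counts of full turns remain. *)
Lemma winding_number_count (P : 'M[R]_(n, 3)) (xi O : 'rV[R]_3) (r : R) (t : 'I_n -> R) :
  0 < r -> (forall i, t i != t (ordS i)) ->
  (forall i, enorm (row i P - O) = r) ->
  (forall i, dot (cross (row i P - O) (row (ordS i) P - O)) xi =
     circle_x r (t i) * circle_y r (t (ordS i)) - circle_y r (t i) * circle_x r (t (ordS i))) ->
  (forall i, dot (row i P - O) (row (ordS i) P - O) =
     circle_x r (t i) * circle_x r (t (ordS i)) + circle_y r (t i) * circle_y r (t (ordS i))) ->
  (forall i, dot (cross (row i P - O) (row (ordS i) P - O)) xi != 0) ->
  winding_number P xi O =
    (num_left_edges P xi O)%:R - #|[pred i | (t (ordS i) < t i)%R]|%:R.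
Proof.
move=> r0 tt hr hS hC S0.
have p0 : (2 * pi : R) != 0 by rewrite mulf_neq0 // gt_eqF // pi_gt0.
rewrite /winding_number (eq_bigr (fun i => (atan (t i) - atan (t (ordS i))) *+ 2 + 2 * pi *
   ((left_of_edge P xi O i)%:R - (t (ordS i) < t i)%R%:R))); last first.
  move=> i _; rewrite /signed_angle !hr hC.
  have -> : left_of_edge P xi O i = (0 < dot (cross (row i P - O) (row (ordS i) P - O)) xi).
    rewrite /left_of_edge; congr (0 < dot _ xi).
    by apply/rowP => k; rewrite !mxE; ring.
  by have := S0 i; rewrite hS => S0'; apply: acos_circle.
rewrite big_split /= -mulr_sumr sumrB sumrMnl.
have -> : \sum_i (atan (t i) - atan (t (ordS i))) = 0.
  by apply: oppr_inj; rewrite oppr0 -sumrN -[RHS](sum_ordS_sub (fun i => atan (t i)));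
     apply: eq_bigr => i _; rewrite opprB.
rewrite mul0rn add0r mulrC mulKf //; congr (_ - _).
  by rewrite -natr_sum ?/num_left_edges -sum1_card [in RHS]big_mkcond.
by rewrite -natr_sum ?/num_left_edges -sum1_card [in RHS]big_mkcond.
Qed.
End Winding.

(** * Frames and points on the circle *)

Section Frame.
Variable R : realType.
Implicit Types (u v w f g xi : 'rV[R]_3).

Lemma dotC u v : dot u v = dot v u.
Proof. by rewrite !dotE; ring. Qed.

Lemma dotDl u v w : dot (u + v) w = dot u w + dot v w.
Proof. by rewrite !dotE !mxE; ring. Qed.

Lemma dotZl a u w : dot (a *: u) w = a * dot u w.
Proof. by rewrite !dotE !mxE; ring. Qed.

Lemma dot_crossl u v : dot (cross u v) u = 0.
Proof. by rewrite !dotE !crossE; ring. Qed.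

Lemma dot_crossr u v : dot (cross u v) v = 0.
Proof. by rewrite !dotE !crossE; ring. Qed.

Lemma lagrange u v : dot (cross u v) (cross u v) = dot u u * dot v v - dot u v ^+ 2.
Proof. by rewrite !dotE !crossE; ring. Qed.

Lemma mul_rows3_tr u f g w k : (u *m (rows3 f g w)^T) 0 k = dot u (row k (rows3 f g w)).
Proof. by rewrite mxE; apply: eq_bigr => j _; rewrite !mxE. Qed.

Lemma row_rows3 f g w : (row 0 (rows3 f g w) = f) * (row 1 (rows3 f g w) = g)
  * (row 2 (rows3 f g w) = w).
Proof. by split; [split|]; rewrite rowK. Qed.

Lemma orthonormal_frame f xi : dot f f = 1 -> dot xi xi = 1 -> dot f xi = 0 ->
  let A := (rows3 f (cross xi f) xi)^T in
  A *m A^T = 1%:M /\ \det A = 1.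
Proof.
move=> ff xx fx A.
have gg : dot (cross xi f) (cross xi f) = 1.
  by rewrite lagrange ff xx dotC fx; ring.
have gx : dot (cross xi f) xi = 0 := dot_crossl _ _.
have gf : dot (cross xi f) f = 0 := dot_crossr _ _.
split.
  apply: mulmx1C; rewrite /A trmxK; apply/row_matrixP => i; rewrite row_mul.
  apply/rowP => k; rewrite mul_rows3_tr.
  by case: (ord3P i) => ->; case: (ord3P k) => ->; rewrite !row_rows3 ?mxE //=
     1?dotC // ?ff ?xx ?gg // dotC.
rewrite /A det_tr det_rows3.
have -> : cross f (cross xi f) = dot f f *: xi - dot f xi *: f.
  by apply/rowP => k; case: (ord3P k) => ->; rewrite !crossE !mxE !dotE; ring.
by rewrite ff fx scale1r scale0r subr0.
Qed.

(** Pigeonhole: [n] vertices cannot occupy n + 1 distinct points of the circle. *)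
Lemma exists_free_direction (n : nat) (p : 'I_n -> 'rV[R]_3) xi r : (0 < n)%N ->
  0 < r -> dot xi xi = 1 -> (forall i, dot (p i) (p i) = r ^+ 2) ->
  (forall i, dot (p i) xi = 0) ->
  exists f, [/\ dot f f = 1, dot f xi = 0 & forall i, p i != r *: f].
Proof.
move=> n0 r0 xx pp px; have rn0 : r != 0 by rewrite gt_eqF.
have [f [ff fx]] : exists f, dot f f = 1 /\ dot f xi = 0.
  exists (r^-1 *: p (Ordinal n0)); rewrite !dotZl px mulr0; split => //.
  by rewrite dotC dotZl pp; field.
pose g := cross xi f.
have gg : dot g g = 1 by rewrite lagrange ff xx dotC fx; ring.
have gx : dot g xi = 0 := dot_crossl _ _.
have gf : dot g f = 0 := dot_crossr _ _.
(* Rational parametrisation of the unit circle at natural numbers; the component along [f]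
   determines k^2 and hence k. *)
pose c (k : nat) := ((1 - k%:R ^+ 2) / (1 + k%:R ^+ 2)) *: f
   + (2 * k%:R / (1 + k%:R ^+ 2)) *: g : 'rV[R]_3.
have k0 (k : nat) : 1 + k%:R ^+ 2 != 0 :> R.
  by rewrite gt_eqF // ltr_pwDl ?sqr_ge0.
have cf k : dot (c k) f = (1 - k%:R ^+ 2) / (1 + k%:R ^+ 2).
  by rewrite dotDl !dotZl ff gf; ring.
have [[k hk]|hn] := pselect (exists k : 'I_n.+1, forall i, p i != r *: c k).
  exists (c k); split => //; last by rewrite dotDl !dotZl fx gx; ring.
  rewrite {2}/c dotC dotDl !dotZl (dotC _ (c k)) cf (dotC g) dotDl !dotZl gg (dotC f) gf.
  by field; exact: k0.
have hit (k : 'I_n.+1) : exists i, p i = r *: c k.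
  have [//|hi] := pselect (exists i, p i = r *: c k).
  by case: hn; exists k => i; apply/eqP => pi; apply: hi; exists i.
have [h hE] := boolp.choice hit.
suff /leq_card : injective h by rewrite !card_ord ltnn.
move=> k l hkl; apply: val_inj => /=.
have ckl : c k = c l by apply: (scalerI rn0); rewrite -!hE hkl.
have := cf k; rewrite ckl cf => /eqP.
rewrite eqr_div // => /eqP E.
have : (k%:R : R) ^+ 2 = l%:R ^+ 2 by lra.
by move=> /(pexpIrn (ltn0Sn 1) (ler0n _ _) (ler0n _ _)) /eqP; rewrite eqr_nat => /eqP.
Qed.

Lemma circle_param (r X Y : R) : X ^+ 2 + Y ^+ 2 = r ^+ 2 -> X != r ->
  X = circle_x r (Y / (r - X)) /\ Y = circle_y r (Y / (r - X)).
Proof.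
move=> h Xr; have rX : r - X != 0 by rewrite subr_eq0 eq_sym.
have r0 : r != 0.
  apply: contra Xr => /eqP r0; move: h; rewrite r0 expr0n => /eqP.
  by rewrite paddr_eq0 ?sqr_ge0 // !sqrf_eq0 => /andP[].
have E : (Y / (r - X)) ^+ 2 + 1 = 2 * r / (r - X).
  have -> : (Y / (r - X)) ^+ 2 = Y ^+ 2 / (r - X) ^+ 2 by rewrite expr_div_n.
  have -> : Y ^+ 2 = r ^+ 2 - X ^+ 2 by rewrite -h; ring.
  by field.
rewrite /circle_x /circle_y E; split; last by field; rewrite rX r0.
have -> : (Y / (r - X)) ^+ 2 - 1 = 2 * X / (r - X).
  by move/eqP: E; rewrite -subr_eq0 => /eqP E; apply/eqP; rewrite -subr_eq0; apply/eqP;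
     rewrite -[RHS]E; field.
by field; rewrite rX r0.
Qed.

(** |p' - p|^2 |p' + p|^2 = (|p'|^2 - |p|^2)^2 + 4 (p x p')^2, and the right side vanishes. *)
Lemma antipodal (r X Y X' Y' : R) : X ^+ 2 + Y ^+ 2 = r ^+ 2 -> X' ^+ 2 + Y' ^+ 2 = r ^+ 2 ->
  X * Y' - Y * X' = 0 -> (X' = X /\ Y' = Y) \/ (X' = - X /\ Y' = - Y).
Proof.
move=> h h' S.
have E : ((X' - X) ^+ 2 + (Y' - Y) ^+ 2) * ((X' + X) ^+ 2 + (Y' + Y) ^+ 2) = 0.
  apply: (@eq_of_sub_eq0 _ _ _ ((X' ^+ 2 + Y' ^+ 2 - (X ^+ 2 + Y ^+ 2)) ^+ 2
     + 4 * (X * Y' - Y * X') ^+ 2)); first by ring.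
  by rewrite h h' S; ring.
have [e|e] := orP (eq_ind _ (fun b => is_true b) (introT eqP E) _ (mulf_eq0 _ _)).
- by left; move: e; rewrite paddr_eq0 ?sqr_ge0 // !sqrf_eq0 !subr_eq0 => /andP[/eqP-> /eqP->].
- by right; move: e; rewrite paddr_eq0 ?sqr_ge0 // !sqrf_eq0 !addr_eq0 => /andP[/eqP-> /eqP->].
Qed.

End Frame.

Section Cyclic.
Variables (R : realType) (n : nat) (L : 'I_n -> R).

Lemma canonical_position (P : 'M[R]_(n, 3)) (xi O : 'rV[R]_3) :
  (0 < n)%N -> linkage L -> decorated L (P, xi) -> inscribed_with_centre P xi O ->
  ~ central P O ->
  exists (y : config R n) (r : R) (t : 'I_n -> R),
  [/\ isometric (P, xi) y, r != 0, forall i, t i != t (ordS i),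
      [/\ forall i, y.1 i 0 = circle_x r (t i), forall i, y.1 i 1 = circle_y r (t i),
          forall i, y.1 i 2 = 0 & y.2 = delta_mx 0 2] &
      winding_number P xi O =
      (num_left_edges P xi O)%:R - #|[pred i | (t (ordS i) < t i)%R]|%:R].
Proof.
move=> n0 hL [hP /= hxi] [hplane [r r0 hr]] hnc.
have xx : dot xi xi = 1 by rewrite -enorm_sqr hxi expr1n.
pose p i := row i P - O.
have pp i : dot (p i) (p i) = r ^+ 2 by rewrite -enorm_sqr hr.
have [f [ff fx fp]] := exists_free_direction n0 r0 xx pp hplane.
have [AA dA] := orthonormal_frame ff xx fx.
move: AA dA; set A := (rows3 f (cross xi f) xi)^T => AA dA.
have [y [iy yp yxi]] : exists y, [/\ isometric (P, xi) y,
    forall i, row i y.1 = p i *m A & y.2 = xi *m A].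
  exists (motion A (- (O *m A)) (P, xi)); split => // [|i].
    exact: isometric_motion.
  by rewrite row_motion /= /p mulmxBl.
have ye i k : y.1 i k = (p i *m A) 0 k by rewrite -yp [RHS]mxE.
have y2 : y.2 = delta_mx 0 2.
  rewrite yxi; apply/rowP => k; rewrite mul_rows3_tr; case: (ord3P k) => ->; rewrite row_rows3 mxE //=.
    by rewrite dotC.
  by rewrite dotC dot_crossl.
have y0z i : y.1 i 2 = 0 by rewrite ye mul_rows3_tr row_rows3 hplane.
have yr i : y.1 i 0 ^+ 2 + y.1 i 1 ^+ 2 = r ^+ 2.
  by rewrite -(pp i) -(dot_rot _ _ AA) dotE -!ye y0z; ring.
have inj u v : u *m A = v *m A -> u = v.
  by move=> /(congr1 (mulmx^~ A^T)); rewrite -!mulmxA AA !mulmx1.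
have y3P i (q : 'rV[R]_3) : y.1 i 0 = q 0 0 -> y.1 i 1 = q 0 1 -> q 0 2 = 0 ->
    p i *m A = q.
  by move=> h0 h1 h2; apply/rowP => k; case: (ord3P k) => ->;
     rewrite -ye ?h0 ?h1 ?y0z ?h2.
have yr0 i : y.1 i 0 != r.
  apply/eqP => yE; move/eqP: (fp i); apply; apply: inj.
  have y1 : y.1 i 1 = 0.
    have := yr i; rewrite yE -[RHS]addr0 => /addrI/eqP.
    by rewrite sqrf_eq0 => /eqP.
  have fA k : (f *m A) 0 k = dot f (row k (rows3 f (cross xi f) xi)) by rewrite mul_rows3_tr.
  apply: y3P; rewrite -scalemxAl mxE fA row_rows3 ?ff ?fx ?mulr1 ?mulr0 //.
  by rewrite y1 dotC dot_crossr mulr0.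
pose t i := y.1 i 1 / (r - y.1 i 0).
have tE i := circle_param (yr i) (yr0 i); rewrite -/(t _) in tE.
have yx i : y.1 i 0 = circle_x r (t i) by case: (tE i).
have yy i : y.1 i 1 = circle_y r (t i) by case: (tE i).
have p_neq i : p (ordS i) <> p i.
  move=> h; have := hL i; rewrite -(hP i) /= (_ : row (ordS i) P - row i P = 0).
    by rewrite /enorm dotE !mxE !mul0r !addr0 sqrtr0 ltxx.
  by move/(congr1 (+%R^~ O)): h; rewrite /p !subrK => ->; rewrite subrr.
have t_neq i : t i != t (ordS i).
  apply/eqP => ht; case: (p_neq i); apply: inj; apply: y3P.
  - by rewrite -ye !yx ht.
  - by rewrite -ye !yy ht.
  - by rewrite -ye y0z.
have crossE' i : dot (cross (p i) (p (ordS i))) xi =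
    y.1 i 0 * y.1 (ordS i) 1 - y.1 i 1 * y.1 (ordS i) 0.
  rewrite -(dot_cross_rot _ _ _ dA) -yxi y2 dotE !crossE -!ye !y0z !mxE /=.
  by ring.
exists y, r, t; split => //; first by rewrite gt_eqF.
apply: (winding_number_count r0 t_neq hr) => i.
- by rewrite -!yx -!yy; exact: crossE'.
- by rewrite -!yx -!yy -(dot_rot _ _ AA) dotE -!ye !y0z; ring.
rewrite crossE'; apply/eqP => S0.
have [[h0 h1]|[h0 h1]] := antipodal (yr i) (yr (ordS i)) S0.
  by case: (p_neq i); apply: inj; apply: y3P; rewrite -ye.
(* Antipodal consecutive vertices make [O] the midpoint of their edge, so the polygon would be
   central. *)
apply: hnc; exists i, 2^-1; split; first by apply/andP; split; lra.
have hp : p (ordS i) = - p i.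
  apply: inj; apply: y3P; rewrite mulNmx mxE -ye //.
  by rewrite y0z oppr0.
have -> : row (ordS i) P - row i P = p (ordS i) - p i by rewrite /p opprB addrA subrK.
by rewrite hp /p; apply/rowP => k; rewrite !mxE; field.
Qed.

(** Composing the chart with one fixed motion brings its base point to the canonical position [y]
    without changing the area. *)
Lemma param_hessian (y : config R n) (r : R) (t : 'I_n -> R) X phi :
  local_param L X phi -> X = iso_class y ->
  r != 0 -> (forall i, t i != t (ordS i)) ->
  (forall i, y.1 i 0 = circle_x r (t i)) -> (forall i, y.1 i 1 = circle_y r (t i)) ->
  (forall i, y.1 i 2 = 0) -> y.2 = delta_mx 0 2 ->
  exists (H : 'M[R]_(moduli_dim n)) (U : bool -> 'I_n -> 'cV[R]_(moduli_dim n)),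
  [/\ qjet (fun u => moduli_area (iso_class (phi u))) H, H^T = H &
    forall v : 'rV[R]_(moduli_dim n),
    (v *m H *m v^T) 0 0 = - (2^-1 * \sum_(c : bool) \sum_i
      ((v *m U c (ordS i)) 0 0 - (v *m U c i) 0 0) ^+ 2 / (t i - t (ordS i)))].
Proof.
move=> [c [U [W [[_ Uo U0 phiX phis] [_ _ phiU _ _]]]]] XE r0 t_neq yx yy yz y2.
have /iso_classP/isometricP[A [b [AA dA yE]]] : iso_class (phi 0) = iso_class y.
  by rewrite phiX.
pose psi u := motion A b (phi u).
have iso u : isometric (phi u) (psi u) by exact: isometric_motion.
have psi0 : psi 0 = y by [].
have -> : (fun u => moduli_area (iso_class (phi u))) = (fun u => vector_area (psi u)).
  by apply/funext => u; rewrite moduli_area_iso_class; exact: vector_area_isometric.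
have jv i k : jet2 (fun u => (phi u).1 i k).
  have [l cl lE] := vertex_coordinate R i k.
  rewrite (_ : (fun u => _) = l \o phi); last by apply/funext => u; rewrite /= lE.
  exact: jet2_linear phis.
have jn k : jet2 (fun u => (phi u).2 0 k).
  have [l cl lE] := normal_coordinate R n k.
  rewrite (_ : (fun u => _) = l \o phi); last by apply/funext => u; rewrite /= lE.
  exact: jet2_linear phis.
apply: (canonical_hessian (L := L) r0 t_neq) => //; rewrite ?psi0 //.
- move=> i k.
  rewrite (_ : (fun u => _) = fun u => \sum_l (phi u).1 i l * A l k + b 0 k).
    apply: jet2D; last exact: jet2_cst.
    by apply: jet2_sum => l; apply: jet2M; [exact: jv|exact: jet2_cst].
  by apply/funext => u; rewrite !mxE.
- move=> k.
  rewrite (_ : (fun u => _) = fun u => \sum_l (phi u).2 0 l * A l k).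
    by apply: jet2_sum => l; apply: jet2M; [exact: jn|exact: jet2_cst].
  by apply/funext => u; rewrite !mxE.
have : \forall u \near (0 : 'rV[R]_(moduli_dim n)), U u by exact: open_nbhs_nbhs.
apply: filterS => u Uu; have [du _ _] := phiU u Uu.
exact: decorated_isometric du.
Qed.

End Cyclic.

Theorem theorem5p5 (R : realType) (n : nat) (L : 'I_n -> R)
    (P : 'M[R]_(n, 3)) (xi O : 'rV[R]_3)
    (hL : linkage L) (hgen : generic_linkage L)
    (hPxi : decorated L (P, xi))
    (horth : orthogonal_to_polygon P xi)
    (hcyc : inscribed_with_centre P xi O)
    (hnc : ~ central P O)
    (hnd : nondegenerate_critical_point L (@moduli_area R n)
             (iso_class (P, xi))) :
  exists2 m : nat,
    has_morse_index L (@moduli_area R n) (iso_class (P, xi)) m &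
    m%:R = 2 * (num_left_edges P xi O)%:R - 2 * winding_number P xi O - 2 :> R.
Proof.
(* The empty polygon is collinear, so genericity excludes [n = 0]. *)
have n0 : (0 < n)%N.
  case: n L P hL hgen hPxi {horth hcyc hnc hnd} => // L' P' _ hgen' [hP' _].
  by case: (hgen' _ hP'); exists 0, 0; case.
have [y [r [t [/iso_classP yX r0 t_neq [yx yy yz y2] wE]]]] :=
  canonical_position n0 hL hPxi hcyc hnc.
have [phi hphi [_ hess_unit]] := hnd.
have hessian_at psi : local_param L (iso_class (P, xi)) psi -> _ :=
  fun h => param_hessian h yX r0 t_neq yx yy yz y2.
pose c i := t i - t (ordS i).
have c0 i : c i != 0 by rewrite subr_eq0.
have sc : \sum_i c i = 0.
  by rewrite sumrB sum_ordS subrr.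
have [H0 [U0 [q0 H0s _]]] := hessian_at _ hphi.
have H0u : H0 \in unitmx by case: q0 => _ <- _.
have index psi : local_param L (iso_class (P, xi)) psi ->
    num_neg_eigenvalues (hessian (fun u => moduli_area (iso_class (psi u))) 0)
      (2 * #|[pred i | (0 < c i)%R]| - 2) /\
    (0 < #|[pred i | (0 < c i)%R]|)%N.
  move=> hpsi; have [H [U [qH Hs HE]]] := hessian_at _ hpsi.
  have [_ -> _] := qH.
  apply: (index_of_cyclic_form n0 c0 sc Hs _ HE).
  (* Nondegeneracy is given in the single chart [phi]; congruence by the Jacobian of the transition
     map carries it to [psi]. *)
  have [tau [dt t0 ht]] := chart_change hphi hpsi.
  have [tau' [dt' t0' ht']] := chart_change hpsi hphi.
  have Ju := chart_change_unit hphi dt t0 dt' t0' ht ht'.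
  rewrite (hessian_transfer H0s Hs q0 qH dt t0).
    by rewrite !unitmx_mul Ju H0u unitmx_tr Ju.
  by move: ht; apply: filterS => u /iso_classP ->.
have [hidx Npos] := index _ hphi.
exists (2 * #|[pred i | (0 < c i)%R]| - 2)%N.
  by split; [exists phi|move=> psi /index[]].
(* With N this cardinal, omega = e - N turns 2 e - 2 omega - 2 into 2 N - 2; the subtraction in the
   index is exact because N is positive. *)
have NE : #|[pred i | (t (ordS i) < t i)%R]| = #|[pred i | (0 < c i)%R]|.
  by apply: eq_card => i; rewrite !inE subr_gt0.
rewrite wE NE natrB ?natrM; last by rewrite -[2%N]muln1 leq_pmul2l.
by ring.
Qed.
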